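(* Let $G$ be a finite group, $\omega,\eta\in Z^3(G,U(1))$, and let $\psi=(p,u,r,v)\colon\mathcal D^\omega(G)\to\mathcal D^\eta(G)$ be an isomorphism of quasi-bialgebras, with associated subgroups $A,B\subseteq G$. Let $\theta,\gamma$ be the phases of $\omega$ and $\theta',\gamma'$ the phases of $\eta$. Then $\psi$ is rigid if and only if all of the following hold. 1. $\omega\in Z^3(G/A,U(1))$. 2. $\gamma_g(u^*(x),u^*(y))=\gamma'_{v(g)}(x,y)$ for all $g,x,y\in G$. 3. $\theta_{u^*(x)}(g,h)=\theta'_x(v(g),v(h))$ for all $g,h,x\in G$. 4. $\theta'_x(y,z)=1$ for all $x\in G$ and $(y,z)\in (B\times \operatorname{Im}(v))\cup(\operatorname{Im}(v)\times B)\cup(B\times B)$. 5. $\gamma'_b(x,y)=1$ for all $b\in B$ and $x,y\in G$.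
   Context: All algebras are over $\mathbb C$. $\mathbb CG$ is the group Hopf algebra and $\mathbb C^G$ its dual with dual basis $(e_g)$, unit $\varepsilon=\sum_ge_g$, counit $\mathrm{ev}_1(e_g)=\delta_{g,1}$. $Z^3(G,U(1))$ is the set of normalized 3-cocycles: functions $\omega\colon G^3\to U(1)$ with $\omega(g,1,h)=1$ and $\omega(a,b,c)\omega(a,bc,d)\omega(b,c,d)=\omega(ab,c,d)\omega(a,b,cd)$. For a normal subgroup $N$, ''$\omega\in Z^3(G/N,U(1))$'' means that $\omega$ is the pullback of a normalized 3-cocycle of $G/N$ along $G\to G/N$. The phases of $\omega$ are $$\theta_g(x,y)=\frac{\omega(g,x,y)\,\omega(x,y,(xy)^{-1}gxy)}{\omega(x,x^{-1}gx,y)},\qquad \gamma_x(g,h)=\frac{\omega(g,h,x)\,\omega(x,x^{-1}gx,x^{-1}hx)}{\omega(g,x,x^{-1}hx)},$$ extended multilinearly to $\mathbb CG$ in all arguments where necessary. The twisted double $\mathcal D^\omega(G)$ has underlying space $\mathbb C^G\otimes\mathbb CG$, basis $e_g\#x$, multiplication $(e_g\#x)(e_h\#y)=\delta_{g,xhx^{-1}}\theta_g(x,y)e_g\#xy$, unit $\varepsilon\#1$, comultiplication $\Delta(e_g\#x)=\sum_t\gamma_x(gt^{-1},t)e_{gt^{-1}}\#x\otimes e_t\#x$, counit $\mathrm{ev}_1\otimes\varepsilon$, coassociator $\sum_{a,b,c}\omega(a,b,c)^{-1}e_a\#1\otimes e_b\#1\otimes e_c\#1$. $\mathcal D(G)=\mathcal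 D^1(G)$ is the untwisted double, a Hopf algebra on the same space. A morphism of quasi-bialgebras is a unital algebra morphism respecting comultiplications, counits and coassociators. Components: every quasi-bialgebra morphism $\psi\colon\mathcal D^\omega(G)\to\mathcal D^\eta(G)$ is written $\psi=(p,u,r,v)$ where $p\colon\mathbb C^G\to\mathbb CG$ is a Hopf algebra morphism and $u\colon\mathbb C^G\to\mathbb C^G$, $r\colon\mathbb CG\to\mathbb C^G$, $v\colon\mathbb CG\to\mathbb CG$ are linear maps preserving units and counits with $\psi(e_g\#x)=\big(\sum_{k\in G}u(e_{gk^{-1}})\#p(e_k)\big)\cdot(r(x)\#v(x))$; explicitly $u(e_g)=(\mathrm{id}\otimes\varepsilon)\psi(e_g\#1)$, $p(e_g)=(\mathrm{ev}_1\otimes\mathrm{id})\psi(e_g\#1)$, $r(x)=(\mathrm{id}\otimes\varepsilon)\psi(\varepsilon\#x)$, $v(x)=(\mathrm{ev}_1\otimes\mathrm{id})\psi(\varepsilon\#x)$. $u^*\colon\mathbb CG\to\mathbb CG$ is the linear dual of $u$. The subgroups $A,B$ are the abelian subgroups of $G$ such that $p$ factors as $\mathbb C^G\to\mathbb C^A\cong\mathbb CB\hookrightarrow\mathbb CG$ (restriction, Hopf isomorphism, inclusion); since $\psi$ is an isomorphism, $A$ and $B$ are central. In condition 4, $\operatorname{Im}(v)$ means the set $\{v(g):g\in G\}$. $\psi$ is rigid if, as a linear map of $\mathbb C^G\otimes\mathbb CG$, it is also a morphism of Hopf algebras $\mathcal D(G)\to\mathcal D(G)$. *)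

(* Defs.v *)
From HB Require Import structures.
From mathcomp Require Import all_boot all_order all_algebra all_fingroup.
From mathcomp Require Import complex reals.

Set Implicit Arguments.
Unset Strict Implicit.
Unset Printing Implicit Defensive.

Import GRing.Theory Num.Theory.
Local Open Scope ring_scope.

(* Every space in sight has a distinguished finite basis, and is represented by
   the coordinate functions on that basis.  For a finite group G, both C G (basis
   the group elements) and C^G (basis the e_g) are {ffun G -> C^o}, the twisted
   doubles live on {ffun G * G -> C^o} with e_g # x the basis vector (g, x), and
   V (x) W is the coordinate space on the product of the two bases. *)
Notation fvect K I := {ffun I -> K^o}.

Section FreeSpaces.
Variable K : numFieldType.

Definition bas (I : finType) (i : I) : fvect K I := [ffun j => (j == i)%:R].

Definition tens (I J : finType) (a : fvect K I) (b : fvect K J) :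
  fvect K (I * J)%type := [ffun ij => a ij.1 * b ij.2].

Definition tens_map (I J I' J' : finType)
    (f : fvect K I -> fvect K I') (g : fvect K J -> fvect K J')
    (a : fvect K (I * J)%type) : fvect K (I' * J')%type :=
  \sum_ij a ij *: tens (f (bas ij.1)) (g (bas ij.2)).

(* For f : C^I -> C^J, the transpose (C^J)^* -> (C^I)^* in the dual bases. *)
Definition dual_map (I J : finType) (f : fvect K I -> fvect K J)
    (y : fvect K J) : fvect K I := [ffun i => \sum_j f (bas i) j * y j].

Definition trilinear (I : finType) (t : I -> I -> I -> K)
    (a b c : fvect K I) : K :=
  \sum_i \sum_j \sum_k a i * b j * c k * t i j k.

End FreeSpaces.

(* Structure maps only: the axioms are not part of these records. *)
Record bialg_data (K : numFieldType) (I : finType) := BialgData {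
  bmul : fvect K I -> fvect K I -> fvect K I;
  bone : fvect K I;
  bcomul : fvect K I -> fvect K (I * I)%type;
  bcounit : fvect K I -> K
}.

Record quasi_bialg_data (K : numFieldType) (I : finType) := QuasiBialgData {
  qbialg :> bialg_data K I;
  coassoc : fvect K (I * I * I)%type
}.

Record hopf_data (K : numFieldType) (I : finType) := HopfData {
  hbialg :> bialg_data K I;
  antipode : fvect K I -> fvect K I
}.

Section Morphisms.
Variables (K : numFieldType) (I J : finType).

Definition bialg_morphism (H : bialg_data K I) (H' : bialg_data K J)
    (f : {linear fvect K I -> fvect K J}) : Prop :=
  [/\ forall a b, f (bmul H a b) = bmul H' (f a) (f b),
      f (bone H) = bone H',
      forall a, bcomul H' (f a) = tens_map f f (bcomul H a)
    & forall a, bcounit H' (f a) = bcounit H a].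

Definition quasi_bialg_morphism (H : quasi_bialg_data K I)
    (H' : quasi_bialg_data K J) (f : {linear fvect K I -> fvect K J}) : Prop :=
  bialg_morphism H H' f /\ tens_map (tens_map f f) f (coassoc H) = coassoc H'.

Definition quasi_bialg_isomorphism (H : quasi_bialg_data K I)
    (H' : quasi_bialg_data K J) (f : {linear fvect K I -> fvect K J}) : Prop :=
  quasi_bialg_morphism H H' f /\ bijective f.

Definition hopf_morphism (H : hopf_data K I) (H' : hopf_data K J)
    (f : {linear fvect K I -> fvect K J}) : Prop :=
  bialg_morphism H H' f /\ forall a, f (antipode H a) = antipode H' (f a).

Definition hopf_isomorphism (H : hopf_data K I) (H' : hopf_data K J)
    (f : {linear fvect K I -> fvect K J}) : Prop :=
  hopf_morphism H H' f /\ bijective f.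

End Morphisms.

(* Normalized 3-cocycles with values in U(1). *)
Definition cocycle3 (K : numFieldType) (gT : finGroupType)
    (w : gT -> gT -> gT -> K) : Prop :=
  [/\ forall a b c, `|w a b c| = 1,
      forall g h, w g 1%g h = 1
    & forall a b c d, w a b c * w a (b * c)%g d * w b c d
                      = w (a * b)%g c d * w a b (c * d)%g].

Section Cocycles.
Variables (K : numFieldType) (gT : finGroupType).
Implicit Type w : gT -> gT -> gT -> K.

(* The normalized cocycles pulled back from G / N.  For N normal in G = setT,
   coset_of N is the full quotient group G / N and coset N the projection. *)
Definition cocycle3_quo (N : {group gT}) w : Prop :=
  exists2 w' : coset_of N -> coset_of N -> coset_of N -> K, cocycle3 w'
  & forall a b c, w a b c = w' (coset N a) (coset N b) (coset N c).

(* theta w g x y is theta_g(x, y); gamma w x g h is gamma_x(g, h). *)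
Definition theta w (g x y : gT) : K :=
  w g x y * w x y ((x * y)^-1 * g * (x * y))%g / w x (x^-1 * g * x)%g y.

Definition gamma w (x g h : gT) : K :=
  w g h x * w x (x^-1 * g * x)%g (x^-1 * h * x)%g / w g x (x^-1 * h * x)%g.

End Cocycles.

Section Doubles.
Variables (K : numFieldType) (gT : finGroupType).
Implicit Type w : gT -> gT -> gT -> K.

Definition groupalg : hopf_data K gT :=
  HopfData
    (BialgData (fun a b => \sum_g \sum_h (a g * b h) *: bas K (g * h)%g)
               (bas K 1%g)
               (fun a => \sum_g a g *: bas K (g, g))
               (fun a => \sum_g a g))
    (fun a => \sum_g a g *: bas K g^-1%g).

Definition dualalg : hopf_data K gT :=
  HopfData
    (BialgData (fun a b => [ffun g => a g * b g])
               [ffun=> 1]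
               (fun a => [ffun gh => a (gh.1 * gh.2)%g])
               (fun a => a 1%g))
    (fun a => [ffun g => a g^-1%g]).

Definition tdouble_bialg w : bialg_data K (gT * gT)%type :=
  BialgData
    (fun a b => \sum_gx \sum_hy
       (a gx * b hy * (gx.1 == gx.2 * hy.1 * gx.2^-1)%g%:R
          * theta w gx.1 gx.2 hy.2) *: bas K (gx.1, gx.2 * hy.2)%g)
    (tens (bone dualalg) (bone groupalg))
    (fun a => \sum_gx \sum_t
       (a gx * gamma w gx.2 (gx.1 * t^-1)%g t)
          *: bas K ((gx.1 * t^-1)%g, gx.2, (t, gx.2)))
    (fun a => \sum_x a (1%g, x)).

Definition tdouble w : quasi_bialg_data K (gT * gT)%type :=
  QuasiBialgData (tdouble_bialg w)
    (\sum_a \sum_b \sum_c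
       (w a b c)^-1 *: bas K ((a, 1%g), (b, 1%g), (c, 1%g))).

(* The antipode is S (e_g # x) = (eps # x^-1) (e_(g^-1) # 1). *)
Definition drinfeld_double : hopf_data K (gT * gT)%type :=
  HopfData (tdouble_bialg (fun _ _ _ => 1))
    (fun a => \sum_gx
       a gx *: bas K ((gx.2^-1 * gx.1^-1 * gx.2)%g, gx.2^-1%g)).

(* id (x) eps and ev_1 (x) id, on C^G (x) C G. *)
Definition id_eps (a : fvect K (gT * gT)%type) : fvect K gT :=
  [ffun g => bcounit groupalg [ffun x => a (g, x)]].

Definition ev1_id (a : fvect K (gT * gT)%type) : fvect K gT :=
  [ffun x => bcounit dualalg [ffun g => a (g, x)]].

Section Components.
Variable psi : fvect K (gT * gT)%type -> fvect K (gT * gT)%type.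

Definition comp_p (f : fvect K gT) := ev1_id (psi (tens f (bone groupalg))).
Definition comp_u (f : fvect K gT) := id_eps (psi (tens f (bone groupalg))).
Definition comp_r (y : fvect K gT) := id_eps (psi (tens (bone dualalg) y)).
Definition comp_v (y : fvect K gT) := ev1_id (psi (tens (bone dualalg) y)).

End Components.

End Doubles.

Arguments groupalg : clear implicits.
Arguments dualalg : clear implicits.
Arguments drinfeld_double : clear implicits.

Section AssociatedSubgroups.
Variables (K : numFieldType) (gT : finGroupType).

Definition restr (A : {group gT}) (f : fvect K gT) : fvect K [subg A] :=
  [ffun a => f (sgval a)].

Definition incl (B : {group gT}) (y : fvect K [subg B]) : fvect K gT :=
  \sum_b y b *: bas K (sgval b).

(* p factors as C^G ->> C^A ~ C B >-> C G. *)
Definition assoc_subgroups (p : fvect K gT -> fvect K gT)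
    (A B : {group gT}) : Prop :=
  [/\ abelian A, abelian B
    & exists2 f : {linear fvect K [subg A] -> fvect K [subg B]},
        hopf_isomorphism (dualalg K [subg A]) (groupalg K [subg B]) f
      & forall x, p x = incl (f (restr A x))].

End AssociatedSubgroups.

Definition rigid (K : numFieldType) (gT : finGroupType)
    (psi : {linear fvect K (gT * gT)%type -> fvect K (gT * gT)%type}) : Prop :=
  hopf_morphism (drinfeld_double K gT) (drinfeld_double K gT) psi.

(* Main.v *)
Require Import Defs.
From mathcomp Require Import all_boot all_order all_algebra all_fingroup.
From mathcomp Require Import complex reals ring.

(** Write psi in coordinates as a matrix X g x h z, the coefficient of e_h # z in
    psi(e_g # x).  Counitality makes psi(f # 1) split as the sum over s in A of
    u(f(. s)) # p(e_s), so injectivity of psi makes A central, and applying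
    ev_1 (x) id to one leg of the coassociator shows that omega is trivial as soon
    as one argument lies in A: hence condition 1 holds for every isomorphism.
    Then the v(x) are group elements, psi(eps # x) = r(x) # v(x), and surjectivity
    gives G = B v(G), so that B is central.

    Comparing coefficients in the multiplicativity and comultiplicativity of psi
    gives, for instance,
      r(x)(h) r(y)(h^v(x)) theta'_h(v(x), v(y)) = theta_{u*(h)}(x, y) r(xy)(h),
      r(x)(ht) gamma'_{v(x)}(h, t) = gamma_x(u*(h), u*(t)) r(x)(h) r(x)(t),
    together with analogues in which psi(eps # x) is replaced by psi(f # 1) for f a
    translation eigenfunction with psi(f # 1) = u(f) # b, b in B.  Rigidity says
    that the same identities hold with all phases removed.  As the coefficients
    r(x)(h) and u(f)(h) never vanish, this amounts to conditions 2 to 5. *)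

Set Implicit Arguments.
Unset Strict Implicit.
Unset Printing Implicit Defensive.

Import GRing.Theory Num.Theory.
Local Open Scope ring_scope.
Local Open Scope complex_scope.

(** * Coordinates on the twisted doubles *)

Section Delta.
Variables (K : numFieldType) (I : finType).

Lemma sum_delta (i : I) (F : I -> K) : \sum_j (j == i)%:R * F j = F i.
Proof.
rewrite (bigD1 i) //= eqxx mul1r big1 ?addr0 // => j /negbTE->.
by rewrite mul0r.
Qed.

Lemma sum_only (i : I) (F : I -> K) :
  (forall j, j != i -> F j = 0) -> \sum_j F j = F i.
Proof. by move=> F0; rewrite (bigD1 i) //= big1 ?addr0. Qed.

Lemma sum_pair (J : finType) (F : I * J -> K) :
  \sum_ij F ij = \sum_i \sum_j F (i, j).
Proof. by rewrite pair_bigA; apply: eq_bigr => -[]. Qed.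

End Delta.

Section Coordinates.
Variable K : numFieldType.

Lemma basE (I : finType) (i j : I) : bas K i j = (j == i)%:R.
Proof. by rewrite ffunE. Qed.

Lemma scale_basE (I : finType) (c : K) (i j : I) :
  (c *: bas K i) j = c * (j == i)%:R.
Proof. by rewrite !ffunE. Qed.

Lemma fvectE (I : finType) (a : fvect K I) : a = \sum_i a i *: bas K i.
Proof.
apply/ffunP => j; rewrite sum_ffunE.
rewrite (sum_only (i := j)) => [|i /negbTE nij]; rewrite scale_basE.
  by rewrite eqxx mulr1.
by rewrite eq_sym nij mulr0.
Qed.

Lemma linear_coord (I J : finType) (f : {linear fvect K I -> fvect K J}) a j :
  f a j = \sum_i a i * f (bas K i) j.
Proof.
rewrite {1}(fvectE a) linear_sum sum_ffunE; apply: eq_bigr => i _.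
by rewrite linearZ ffunE.
Qed.

Lemma tens_mapE (I J I' J' : finType) (f : fvect K I -> fvect K I')
    (g : fvect K J -> fvect K J') a i j :
  tens_map f g a (i, j)
  = \sum_k \sum_l a (k, l) * (f (bas K k) i * g (bas K l) j).
Proof.
rewrite sum_ffunE pair_bigA; apply: eq_bigr => -[k l] _.
by rewrite !ffunE.
Qed.

End Coordinates.

Section DoubleCoordinates.
Variables (K : numFieldType) (gT : finGroupType).
Implicit Types (w : gT -> gT -> gT -> K) (a b : fvect K (gT * gT)%type).
Implicit Types g h x y z : gT.

Lemma thetaE w g x y :
  theta w g x y = w g x y * w x y (g ^ (x * y))%g / w x (g ^ x)%g y.
Proof. by rewrite /theta !conjgE !mulgA. Qed.

Lemma gammaE w x g h :
  gamma w x g h = w g h x * w x (g ^ x)%g (h ^ x)%g / w g x (h ^ x)%g.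
Proof. by rewrite /gamma !conjgE !mulgA. Qed.

(** The constraint g = x h x^-1 leaves a single free index: to reach e_h # z, the left factor
    contributes some e_h # k, and the right one is then forced to be e_(h^k) # k^-1 z. *)
Lemma dmulE w a b h z :
  bmul (tdouble_bialg w) a b (h, z)
  = \sum_k a (h, k) * b (h ^ k, k^-1 * z)%g * theta w h k (k^-1 * z)%g.
Proof.
rewrite /= sum_ffunE.
rewrite sum_pair /=.
rewrite (sum_only (i := h)) => [|g neq_gh].
  apply: eq_bigr => k _; rewrite sum_ffunE.
  rewrite (sum_only (i := (h ^ k, k^-1 * z)%g)) => [|[h' y] neq_h'y].
    rewrite scale_basE /= conjgE mulKVg !mulgA mulgV mul1g mulgK !eqxx.
    by rewrite !mulr1.
  rewrite scale_basE /=; case: eqP => [Eh|]; last by rewrite mulr0 !mul0r.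
  case: eqP => [[Ez]|]; last by rewrite mulr0.
  by rewrite Eh Ez conjgE mulKg -!mulgA mulVg mulg1 mulKg eqxx in neq_h'y.
rewrite big1 // => k _; rewrite sum_ffunE big1 // => -[h' y] _.
by rewrite scale_basE xpair_eqE [h == g]eq_sym (negbTE neq_gh) mulr0.
Qed.

Lemma dcomulE w a h x t y :
  bcomul (tdouble_bialg w) a ((h, x), (t, y))
  = (x == y)%:R * (a (h * t, x)%g * gamma w x h t).
Proof.
rewrite /= sum_ffunE (sum_only (i := (h * t, x)%g)) => [|[g x'] neq].
  rewrite sum_ffunE (sum_only (i := t)) => [|s neq].
    rewrite scale_basE /= mulgK !xpair_eqE /= !eqxx /= mulrC.
    by rewrite [y == x]eq_sym.
  rewrite scale_basE; case: eqP => [[_ Et _]|]; last by rewrite mulr0.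
  by rewrite Et eqxx in neq.
rewrite sum_ffunE big1 // => s _; rewrite scale_basE /=.
case: eqP => [[Eh Ex Et _]|]; last by rewrite mulr0.
by rewrite Eh Et Ex mulgKV eqxx in neq.
Qed.

Lemma doneE w h z : bone (tdouble_bialg w) (h, z) = (z == 1%g)%:R.
Proof. by rewrite /= !ffunE /= mul1r. Qed.

(** Product, unit, coproduct and counit axioms on basis vectors, in this order. As [X] is a bare
    array of scalars, one and the same array can be tested against [omega], [eta] and against
    trivial cocycles. *)
Definition double_morphism w w' (X : gT -> gT -> gT -> gT -> K) : Prop :=
  [/\ forall g x g' y h z,
        \sum_k X g x h k * X g' y (h ^ k)%g (k^-1 * z)%g
               * theta w' h k (k^-1 * z)%g
        = (g == g' ^ x^-1)%g%:R * theta w g x y * X g (x * y)%g h z,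
      forall h z, \sum_g X g 1%g h z = (z == 1%g)%:R,
      forall g x h z t z',
        (z == z')%:R * (X g x (h * t)%g z * gamma w' z h t)
        = \sum_s gamma w x (g * s^-1)%g s * X (g * s^-1)%g x h z * X s x t z'
    & forall g x, \sum_z X g x 1%g z = (g == 1%g)%:R].

Section Matrix.
Variable psi : {linear fvect K (gT * gT)%type -> fvect K (gT * gT)%type}.

Definition dcoord g x h z : K := psi (bas K (g, x)) (h, z).

Lemma dcoordE a h z : psi a (h, z) = \sum_g \sum_x a (g, x) * dcoord g x h z.
Proof.
rewrite linear_coord pair_bigA; apply: eq_bigr => -[g x] _ //.
Qed.

Lemma eq_conjV (g h x : gT) : (g == h ^ x^-1)%g = (g ^ x == h)%g.
Proof. by rewrite -(inj_eq (conjg_inj x)) conjgKV. Qed.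

Lemma dmul_bas w g x g' y :
  bmul (tdouble_bialg w) (bas K (g, x)) (bas K (g', y))
  = ((g == g' ^ x^-1)%g%:R * theta w g x y) *: bas K (g, x * y)%g.
Proof.
apply/ffunP => -[h z]; rewrite dmulE scale_basE (sum_only (i := x)) => [|k neq].
  rewrite !basE !xpair_eqE eqxx andbT -[(x^-1 * z == y)%g](inj_eq (mulgI x)).
  rewrite mulKVg eq_conjV.
  have [->|_] := eqVneq h g; last by rewrite !mul0r mulr0.
  have [->|_] := eqVneq z (x * y)%g; last by rewrite andbF mulr0 mul0r mulr0.
  by rewrite andbT mulKg mulr1 mul1r.
by rewrite !basE !xpair_eqE (negbTE neq) andbF !mul0r.
Qed.

Lemma tens_map_dcomulE w a h z t z' :
  tens_map psi psi (bcomul (tdouble_bialg w) a) ((h, z), (t, z'))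
  = \sum_g \sum_x a (g, x) * \sum_s gamma w x (g * s^-1)%g s
       * dcoord (g * s^-1)%g x h z * dcoord s x t z'.
Proof.
rewrite tens_mapE sum_pair exchange_big [RHS]exchange_big /=.
apply: eq_bigr => x _.
under eq_bigr => k _ do rewrite sum_pair /=.
rewrite exchange_big /=.
under [RHS]eq_bigr => g _ do rewrite mulr_sumr.
rewrite [RHS]exchange_big /=; apply: eq_bigr => s _.
rewrite [RHS](reindex_inj (mulIg s)) /=; apply: eq_bigr => k _.
rewrite (sum_only (i := x)) => [|y /negbTE neq].
  by rewrite dcomulE eqxx mul1r mulgK -!mulrA.
by rewrite dcomulE eq_sym neq !mul0r.
Qed.

(** All axioms are linear in each argument, so basis vectors suffice; the converse re-expands
    arbitrary elements in coordinates. *)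
Lemma bialg_morphismE w w' :
  bialg_morphism (tdouble_bialg w) (tdouble_bialg w') psi
  <-> double_morphism w w' dcoord.
Proof.
split=> [[psiM psi1 psiD psi0] | [XM X1 XD X0]]; split.
- move=> g x g' y h z; rewrite -dmulE -psiM dmul_bas linearZ ffunE //.
- move=> h z; rewrite -(doneE w' h z) -psi1 dcoordE; apply: eq_bigr => g _.
  rewrite (sum_only (i := 1%g)) => [|x /negbTE neq]; rewrite doneE.
    by rewrite eqxx mul1r.
  by rewrite neq mul0r.
- move=> g x h z t z'; rewrite -dcomulE psiD tens_map_dcomulE.
  rewrite (sum_only (i := g)) => [|h' /negbTE neq].
    rewrite (sum_only (i := x)) => [|y /negbTE neq].
      by rewrite basE eqxx mul1r.
    by rewrite basE xpair_eqE neq andbF mul0r.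
  by rewrite big1 // => y _; rewrite basE xpair_eqE neq mul0r.
- move=> g x; rewrite -[LHS]/(bcounit (tdouble_bialg w') (psi _)) psi0 /=.
  under eq_bigr => y _ do rewrite basE xpair_eqE andbC eq_sym (eq_sym 1%g).
  rewrite (sum_only (i := x)) => [|y neq]; first by rewrite eqxx.
  by rewrite eq_sym (negbTE neq).
- move=> a b; apply/ffunP => -[h z]; rewrite dmulE /=.
  rewrite linear_sum sum_ffunE.
  transitivity (\sum_k \sum_gx \sum_hy a gx * b hy
      * (dcoord gx.1 gx.2 h k * dcoord hy.1 hy.2 (h ^ k)%g (k^-1 * z)%g
         * theta w' h k (k^-1 * z)%g)); last first.
    apply: eq_bigr => k _; rewrite !linear_coord big_distrlr mulr_suml /=.
    apply: eq_bigr => -[g x] _; rewrite mulr_suml; apply: eq_bigr => -[g' y] _.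
    by rewrite -!/(dcoord _ _ _ _) /=; ring.
  rewrite exchange_big; apply: eq_bigr => -[g x] _.
  rewrite exchange_big linear_sum sum_ffunE; apply: eq_bigr => -[g' y] _.
  rewrite linearZ ffunE -mulr_sumr XM /= conjgE invgK !mulgA.
  by rewrite -[_ *: _]/(_ * _) !mulrA.
- apply/ffunP => -[h z]; rewrite doneE -(X1 h z) dcoordE; apply: eq_bigr => g _.
  rewrite (sum_only (i := 1%g)) => [|x /negbTE neq]; rewrite doneE.
    by rewrite eqxx mul1r.
  by rewrite neq mul0r.
- move=> a; apply/ffunP => -[[h z] [t z']].
  rewrite tens_map_dcomulE dcomulE dcoordE mulr_suml mulr_sumr.
  apply: eq_bigr => g _; rewrite mulr_suml mulr_sumr; apply: eq_bigr => x _.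
  rewrite -XD; ring.
- move=> a /=.
  under eq_bigr => z _ do rewrite dcoordE.
  rewrite exchange_big /= (sum_only (i := 1%g)) => [|g /negbTE neq].
    by rewrite exchange_big; apply: eq_bigr => x _; rewrite -mulr_sumr X0 eqxx mulr1.
  by rewrite exchange_big big1 // => x _; rewrite -mulr_sumr X0 neq mulr0.
Qed.

End Matrix.
End DoubleCoordinates.

(** * Bialgebra morphisms of the untwisted double preserve the antipode *)

(* Left and right inverses agree in the convolution algebra of functions from a
   group to an algebra. *)
Lemma convolution_inverse_unique (gT : finGroupType) (V : nmodType)
    (mul : V -> V -> V) (one : V) (L M N : gT -> V) :
  associative mul -> left_id one mul -> right_id one mul ->
  left_zero 0 mul -> right_zero 0 mul ->
  (forall (F : gT -> V) b, mul (\sum_i F i) b = \sum_i mul (F i) b) ->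
  (forall (F : gT -> V) a, mul a (\sum_i F i) = \sum_i mul a (F i)) ->
  (forall g, \sum_t mul (L (g * t^-1)%g) (M t) = if g == 1%g then one else 0) ->
  (forall g, \sum_t mul (M (g * t^-1)%g) (N t) = if g == 1%g then one else 0) ->
  L =1 N.
Proof.
move=> mulA mul1x mulx1 mul0x mulx0 mul_suml mul_sumr LM MN g.
transitivity (\sum_s \sum_t mul (mul (L (g * s^-1)%g) (M (s * t^-1)%g)) (N t)).
  rewrite (bigD1 1%g) //= [X in _ = _ + X]big1 => [|s /negbTE neq].
    under eq_bigr => t _ do rewrite -mulA.
    by rewrite -mul_sumr MN eqxx mulx1 invg1 mulg1 addr0.
  under eq_bigr => t _ do rewrite -mulA.
  by rewrite -mul_sumr MN neq mulx0.
transitivity (\sum_t mul (if (g * t^-1 == 1)%g then one else 0) (N t)).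
  rewrite exchange_big; apply: eq_bigr => t _.
  rewrite -mul_suml -(LM (g * t^-1)%g); congr (mul _ _).
  rewrite (reindex_inj (mulIg t)) /=.
  by apply: eq_bigr => s _; rewrite invMg mulgA mulgK.
rewrite (bigD1 g) //= mulgV eqxx mul1x big1 ?addr0 // => t neq.
by rewrite -eq_mulgV1 eq_sym (negbTE neq) mul0x.
Qed.

Section Antipode.
Variables (K : numFieldType) (gT : finGroupType).
Implicit Types (a b c : fvect K (gT * gT)%type) (g h x y z s t : gT).

Let w1 : gT -> gT -> gT -> K := fun _ _ _ => 1.
Let mul := bmul (tdouble_bialg w1).
Let one := bone (tdouble_bialg w1).

Lemma theta_trivial g x y : theta w1 g x y = 1.
Proof. by rewrite /theta mulr1 divr1. Qed.

Lemma gamma_trivial x g h : gamma w1 x g h = 1.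
Proof. by rewrite /gamma mulr1 divr1. Qed.

Let mulE a b h z : mul a b (h, z) = \sum_k a (h, k) * b (h ^ k, k^-1 * z)%g.
Proof.
by rewrite /mul dmulE; apply: eq_bigr => k _; rewrite theta_trivial mulr1.
Qed.

Let mulA a b c : mul a (mul b c) = mul (mul a b) c.
Proof.
apply/ffunP => -[h z]; rewrite !mulE.
under [RHS]eq_bigr => k _ do rewrite mulE mulr_suml.
rewrite exchange_big; apply: eq_bigr => k _.
rewrite mulE mulr_sumr (reindex_inj (mulgI k^-1)%g); apply: eq_bigr => l _.
by rewrite -conjgM mulKVg invMg invgK !mulgA mulgK mulrA.
Qed.

Let mul1x a : mul one a = a.
Proof.
apply/ffunP => -[h z]; rewrite mulE (sum_only (i := 1%g)) => [|k /negbTE neq].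
  by rewrite doneE eqxx mul1r conjg1 invg1 mul1g.
by rewrite doneE neq mul0r.
Qed.

Let mulx1 a : mul a one = a.
Proof.
apply/ffunP => -[h z]; rewrite mulE (sum_only (i := z)) => [|k neq].
  by rewrite doneE mulVg eqxx mulr1.
by rewrite doneE -eq_mulVg1 (negbTE neq) mulr0.
Qed.

Let mul_suml (I : finType) (F : I -> _) b :
  mul (\sum_i F i) b = \sum_i mul (F i) b.
Proof.
apply/ffunP => -[h z]; rewrite mulE sum_ffunE.
under [RHS]eq_bigr => i _ do rewrite mulE.
rewrite exchange_big; apply: eq_bigr => k _.
by rewrite sum_ffunE mulr_suml.
Qed.

Let mul_sumr (I : finType) (F : I -> _) a :
  mul a (\sum_i F i) = \sum_i mul a (F i).
Proof.
apply/ffunP => -[h z]; rewrite mulE sum_ffunE.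
under [RHS]eq_bigr => i _ do rewrite mulE.
rewrite exchange_big; apply: eq_bigr => k _.
by rewrite sum_ffunE mulr_sumr.
Qed.

Let mul0x a : mul 0 a = 0.
Proof.
apply/ffunP => -[h z]; rewrite mulE ffunE big1 // => k _.
by rewrite ffunE mul0r.
Qed.

Let mulx0 a : mul a 0 = 0.
Proof.
apply/ffunP => -[h z]; rewrite mulE ffunE big1 // => k _.
by rewrite ffunE mulr0.
Qed.

Let S := antipode (drinfeld_double K gT).

Let antipodeE a h z : S a (h, z) = a ((h^-1) ^ z, z^-1)%g.
Proof.
rewrite /S /= sum_ffunE (sum_only (i := ((h^-1) ^ z, z^-1)%g)) => [|[g x] neq].
  rewrite scale_basE /= xpair_eqE invgK !conjgE !invMg !invgK !mulgA.
  by rewrite mulgV mul1g mulgK !eqxx mulr1.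
rewrite scale_basE /= xpair_eqE; apply/eqP; rewrite mulf_eq0; apply/orP; right.
rewrite pnatr_eq0 eqb0; apply: contra neq => /andP[/eqP-> /eqP->].
by rewrite invgK !conjgE !invMg !invgK !mulgA mulgK mulgV mul1g eqxx.
Qed.

Let antipode_bas g x : S (bas K (g, x)) = bas K ((g^-1) ^ x, x^-1)%g.
Proof.
apply/ffunP => -[h z]; rewrite antipodeE !basE !xpair_eqE.
rewrite (canF_eq invgK); have [->|_] := eqVneq z; last first.
  by rewrite !andbF.
by rewrite !andbT conjVg (canF_eq invgK) -eq_conjV invgK.
Qed.

(** For fixed x, the coproduct of e_g # x is group convolution in g. For this convolution psi S is a
    left inverse and S psi a right inverse of psi, so the two agree. *)
Lemma bialg_morphism_antipode
    (psi : {linear fvect K (gT * gT)%type -> fvect K (gT * gT)%type}) :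
  bialg_morphism (drinfeld_double K gT) (drinfeld_double K gT) psi -> rigid psi.
Proof.
move=> psiH; split=> // a; rewrite -!/(S _).
have /bialg_morphismE[XM X1 XD X0] := psiH.
have [psiM psi1] : (forall a b, psi (mul a b) = mul (psi a) (psi b))
  /\ psi one = one by case: psiH.
suff SX g x : psi (S (bas K (g, x))) = S (psi (bas K (g, x))).
  have S_lin b : S b = \sum_gx b gx *: S (bas K gx).
    rewrite {1}/S /=; apply: eq_bigr => -[g x] _ /=.
    by rewrite antipode_bas conjgE mulgA.
  rewrite S_lin linear_sum /=; apply/ffunP => -[h z].
  rewrite antipodeE dcoordE sum_ffunE sum_pair; apply: eq_bigr => g _.
  by apply: eq_bigr => x _; rewrite linearZ ffunE SX antipodeE.
pose M g := psi (bas K (g, x)).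
pose L g := psi (S (bas K (g, x))); pose N g := S (M g).
suff LN : L =1 N by exact: LN.
apply: (convolution_inverse_unique (M := M) mulA mul1x mulx1 mul0x mulx0)
  => [F b|F b|{}g|{}g]; [exact: mul_suml | exact: mul_sumr | |].
  (* [L] against [M]: psi is multiplicative, so this reduces to the antipode axiom inside the source
     double. *)
  under eq_bigr => t _ do rewrite /L antipode_bas /M -psiM.
  rewrite -linear_sum.
  suff -> : \sum_t mul (bas K (((g * t^-1)^-1 ^ x)%g, x^-1%g)) (bas K (t, x))
      = if g == 1%g then one else 0.
    by case: eqP => _; rewrite ?linear0 // psi1.
  have eqS t : mul (bas K (((g * t^-1)^-1 ^ x)%g, x^-1%g)) (bas K (t, x))
      = (g == 1%g)%:R *: bas K ((t ^ x)%g, 1%g).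
    rewrite /mul dmul_bas theta_trivial mulr1 invgK mulVg (inj_eq (conjg_inj x)).
    rewrite invMg invgK -{2}[t]mulg1 (inj_eq (mulgI t)) eq_invg1.
    by case: eqP => [->|]; rewrite ?scale0r // invg1 mulg1.
  under eq_bigr => t _ do rewrite eqS.
  rewrite -scaler_sumr; case: eqP => _; rewrite ?scale0r // scale1r.
  apply/ffunP => -[h z]; rewrite doneE sum_ffunE.
  rewrite (reindex_inj (conjg_inj x^-1)%g) (sum_only (i := h)) => [|t neq].
    by rewrite basE conjgKV xpair_eqE eqxx.
  by rewrite basE conjgKV xpair_eqE eq_sym (negbTE neq).
apply/ffunP => -[h z]; rewrite sum_ffunE.
(* [M] against [N]: comultiplicativity collapses the sum over t to one coefficient, which vanishes
   unless z = 1 and then sits at h h^-1 = 1; the counit axiom evaluates the remaining sum over k. *)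
transitivity (\sum_k (z == 1%g)%:R * dcoord psi g x 1%g k).
  under eq_bigr => t _ do rewrite mulE.
  rewrite exchange_big; apply: eq_bigr => k _.
  under eq_bigr => t _ do rewrite antipodeE invMg invgK.
  have XD' t' z' : \sum_s dcoord psi (g * s^-1)%g x h k * dcoord psi s x t' z'
      = (k == z')%:R * dcoord psi g x (h * t')%g k.
    have := XD g x h k t' z'; rewrite gamma_trivial mulr1 => ->.
    by apply: eq_bigr => s _; rewrite gamma_trivial mul1r.
  rewrite XD' invMg invgK -{1}[k]mul1g (inj_eq (mulIg k)) eq_sym eq_invg1.
  have [->|_] := eqVneq z 1%g; last by rewrite !mul0r.
  by rewrite mulg1 invMg -mulgA -conjgE conjgK mulgV.
rewrite -mulr_sumr X0; case: (g == 1%g); last by rewrite mulr0 ffunE.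
by rewrite mulr1 doneE.
Qed.

End Antipode.

(** * Consequences of being an isomorphism *)

Section NormalizedCocycles.
Variables (K : numFieldType) (gT : finGroupType) (w : gT -> gT -> gT -> K).
Hypothesis cw : cocycle3 w.
Implicit Types a b c g h x y : gT.

Lemma cocycle3_neq0 a b c : w a b c != 0.
Proof. by have [w1 _ _] := cw; rewrite -normr_eq0 w1 oner_neq0. Qed.

Lemma cocycle3_1m a b : w a 1%g b = 1.
Proof. by have [_ w1 _] := cw. Qed.

(** Normalization is only assumed in the middle slot. The cocycle identity at (1, 1, a, b) says that
    this value equals its own square, and it is non-zero. *)
Lemma cocycle3_1l a b : w 1%g a b = 1.
Proof.
have [_ w1 wM] := cw; have := wM 1%g 1%g a b.
rewrite !mul1g !w1 mul1r => E.
apply: (mulfI (cocycle3_neq0 1 a b)); rewrite mulr1 {1}E.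
by rewrite mulr1.
Qed.

Lemma cocycle3_1r a b : w a b 1%g = 1.
Proof.
have [_ w1 wM] := cw; have := wM a b 1%g 1%g.
rewrite !mulg1 !w1 mulr1 => E.
apply: (mulfI (cocycle3_neq0 a b 1)); rewrite mulr1 E.
by rewrite mul1r.
Qed.

Definition cocycle3_1 := (cocycle3_1l, cocycle3_1m, cocycle3_1r).

Lemma theta_neq0 g x y : theta w g x y != 0.
Proof. by rewrite !mulf_neq0 ?invr_eq0 ?cocycle3_neq0. Qed.

Lemma gamma_neq0 x g h : gamma w x g h != 0.
Proof. by rewrite !mulf_neq0 ?invr_eq0 ?cocycle3_neq0. Qed.

Lemma theta_1 x y : theta w 1%g x y = 1.
Proof. by rewrite thetaE !conj1g !cocycle3_1 !mul1r invr1. Qed.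

Lemma theta_1l g x : theta w g 1%g x = 1.
Proof. by rewrite thetaE mul1g conjg1 !cocycle3_1 !mul1r invr1. Qed.

Lemma theta_1r g x : theta w g x 1%g = 1.
Proof. by rewrite thetaE !cocycle3_1 !mul1r invr1. Qed.

Lemma gamma_1 g h : gamma w 1%g g h = 1.
Proof. by rewrite gammaE !cocycle3_1 !mul1r invr1. Qed.

Lemma gamma_1l x g : gamma w x 1%g g = 1.
Proof. by rewrite gammaE !conj1g !cocycle3_1 !mul1r invr1. Qed.

Lemma gamma_1r x g : gamma w x g 1%g = 1.
Proof. by rewrite gammaE !conj1g !cocycle3_1 !mul1r invr1. Qed.

(** With k in one slot of the cocycle identity, every factor having k as an argument is 1, and what
    remains moves k across a comma; centrality moves k past its neighbour. *)
Lemma cocycle3_translate (A : {pred gT}) :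
  (forall k g, k \in A -> commute k g) ->
  (forall k a b, k \in A -> [/\ w k a b = 1, w a k b = 1 & w a b k = 1]) ->
  forall k a b c, k \in A ->
  [/\ w (k * a)%g b c = w a b c, w a (k * b)%g c = w a b c
    & w a b (k * c)%g = w a b c].
Proof.
move=> cA wA k a b c Ak; have [_ _ wM] := cw.
have wl g h : w k g h = 1 by case: (wA k g h Ak).
have wm g h : w g k h = 1 by case: (wA k g h Ak).
have wr g h : w g h k = 1 by case: (wA k g h Ak).
have := wM a b k c; rewrite !wm !wr !(mul1r, mulr1) => <-.
have := wM k a b c; rewrite !wl !(mul1r, mulr1) => <-.
have := wM a k b c; rewrite !wl !wm !(mul1r, mulr1) => E.
rewrite -(cA k b Ak) E -(cA k a Ak); have := wM k a b c.
by rewrite !wl !(mul1r, mulr1) => <-.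
Qed.

End NormalizedCocycles.

Lemma cocycle3_trivial (K : numFieldType) (gT : finGroupType) :
  @cocycle3 K gT (fun _ _ _ => 1).
Proof. by split=> *; rewrite ?normr1 ?mulr1. Qed.

(** * Cocycles invariant under translation by central elements *)

Section InvariantCocycles.
Variables (K : numFieldType) (gT : finGroupType) (A : {pred gT}).
Hypothesis cA : forall k g, k \in A -> commute k g.

Definition translation_invariant (w : gT -> gT -> gT -> K) : Prop :=
  forall k a b c, k \in A ->
  [/\ w (k * a)%g b c = w a b c, w a (k * b)%g c = w a b c
    & w a b (k * c)%g = w a b c].

Variable w : gT -> gT -> gT -> K.
Hypothesis wA : translation_invariant w.

Let conj_central k x : k \in A -> (k ^ x = k)%g.
Proof. by move=> Ak; rewrite conjgE (cA x Ak) mulKg. Qed.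

Lemma theta_translate k g x y : k \in A -> theta w (k * g)%g x y = theta w g x y.
Proof.
move=> Ak; rewrite !thetaE !conjMg !(conj_central _ Ak).
have [-> _ _] := wA g x y Ak. have [_ -> _] := wA x (g ^ x)%g y Ak.
by have [_ _ ->] := wA x y (g ^ (x * y))%g Ak.
Qed.

Lemma gamma_translate k x g h : k \in A ->
  gamma w x (k * g)%g h = gamma w x g h /\ gamma w x g (k * h)%g = gamma w x g h.
Proof.
move=> Ak; rewrite !gammaE !conjMg !(conj_central _ Ak); split.
  have [-> _ _] := wA g h x Ak; have [_ -> _] := wA x (g ^ x)%g (h ^ x)%g Ak.
  by have [-> _ _] := wA g x (h ^ x)%g Ak.
have [_ -> _] := wA g h x Ak; have [_ _ ->] := wA x (g ^ x)%g (h ^ x)%g Ak.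
by have [_ _ ->] := wA g x (h ^ x)%g Ak.
Qed.

End InvariantCocycles.

(** * Linear independence of rows and of their tensor products *)

Section JointlyInjective.
Variables (K : numFieldType) (I : finType).

(** The relations run over all of [I], not only over [S]: the rows indexed by [S] are independent,
    even modulo the span of the other rows. *)
Definition free_on (S : {pred I}) T (F : I -> T -> K) : Prop :=
  forall c : I -> K, (forall t, \sum_i c i * F i t = 0) ->
  forall i, i \in S -> c i = 0.

(** A tensor product of injective maps is injective: the three families are peeled off one at a
    time, with the other indices frozen. *)
Lemma free_on_tens3 (S1 S2 S3 : {pred I}) T1 T2 T3 (F1 : I -> T1 -> K)
    (F2 : I -> T2 -> K) (F3 : I -> T3 -> K) (D : I -> I -> I -> K) :
  free_on S1 F1 -> free_on S2 F2 -> free_on S3 F3 ->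
  (forall t1 t2 t3,
     \sum_a \sum_b \sum_c D a b c * (F1 a t1 * F2 b t2 * F3 c t3) = 0) ->
  forall a b c, a \in S1 -> b \in S2 -> c \in S3 -> D a b c = 0.
Proof.
move=> free1 free2 free3 D0 a b c Sa Sb Sc.
apply: (free3 (fun c => D a b c)) Sc => t3.
apply: (free2 (fun b => \sum_c D a b c * F3 c t3)) Sb => t2.
apply: (free1 (fun a => \sum_b (\sum_c D a b c * F3 c t3) * F2 b t2)) Sa => t1.
rewrite -[RHS](D0 t1 t2 t3); apply: eq_bigr => a' _.
rewrite mulr_suml; apply: eq_bigr => b' _.
by rewrite !mulr_suml; apply: eq_bigr => c' _; ring.
Qed.

End JointlyInjective.

(** * Coefficients of the images of products and coproducts *)

Section MorphismCoordinates.
Variables (K : numFieldType) (gT : finGroupType).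
Variables (w w' : gT -> gT -> gT -> K) (X : gT -> gT -> gT -> gT -> K).
Implicit Types (g h x y z s t k b : gT).
Hypotheses (cw : cocycle3 w) (cw' : cocycle3 w') (XH : double_morphism w w' X).

Let XM := let: And4 e _ _ _ := XH in e.
Let X1 := let: And4 _ e _ _ := XH in e.
Let XD := let: And4 _ _ e _ := XH in e.
Let X0 := let: And4 _ _ _ e := XH in e.

(* Applying (id (x) eps) (x) (ev_1 (x) id) to a coproduct in a twisted double
   gives back the element, because the cocycles are normalized. *)
Lemma coord_factorl g x h z :
  X g x h z = \sum_s gamma w x (g * s^-1)%g s
                * (\sum_y X (g * s^-1)%g x h y) * X s x 1%g z.
Proof.
have E y : \sum_s gamma w x (g * s^-1)%g s * X (g * s^-1)%g x h y * X s x 1%g z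
    = (y == z)%:R * X g x h y.
  by rewrite -XD mulg1 gamma_1r // mulr1.
rewrite -(sum_delta z (fun y => X g x h y)).
under eq_bigr => y _ do rewrite -E.
rewrite exchange_big; apply: eq_bigr => s _.
by rewrite mulr_sumr mulr_suml.
Qed.

Lemma coord_factorr g x h z :
  X g x h z = \sum_s gamma w x (g * s^-1)%g s
                * X (g * s^-1)%g x 1%g z * \sum_y X s x h y.
Proof.
have E y : \sum_s gamma w x (g * s^-1)%g s * X (g * s^-1)%g x 1%g z * X s x h y
    = (y == z)%:R * X g x h z.
  by rewrite eq_sym -XD mul1g gamma_1l // mulr1.
rewrite -(sum_delta z (fun=> X g x h z)).
under eq_bigr => y _ do rewrite -E.
rewrite exchange_big; apply: eq_bigr => s _.
by rewrite mulr_sumr.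
Qed.

(* qm x is psi(eps # x). *)
Definition qm x h z := \sum_g X g x h z.

(** The image of (e_g # 1)(eps # x) = e_g # x, where theta_g(1, x) = 1. *)
Lemma coord_PQ g x h z : X g x h z
  = \sum_k X g 1%g h k * qm x (h ^ k)%g (k^-1 * z)%g * theta w' h k (k^-1 * z)%g.
Proof.
transitivity (\sum_g' (g == g')%:R * X g x h z).
  rewrite -[LHS](sum_delta g (fun=> X g x h z)); apply: eq_bigr => g' _.
  by rewrite eq_sym.
transitivity (\sum_g' \sum_k X g 1%g h k * X g' x (h ^ k)%g (k^-1 * z)%g
               * theta w' h k (k^-1 * z)%g).
  apply: eq_bigr => g' _.
  by rewrite XM theta_1l // mulr1 invg1 conjg1 mul1g.
rewrite exchange_big; apply: eq_bigr => k _.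
by rewrite mulr_sumr mulr_suml.
Qed.

(** The image of (eps # x)(e_g # 1), which is e_(x g x^-1) # x. *)
Lemma coord_QP g x h z : X (g ^ x^-1)%g x h z
  = \sum_k qm x h k * X g 1%g (h ^ k)%g (k^-1 * z)%g * theta w' h k (k^-1 * z)%g.
Proof.
rewrite -(sum_delta (g ^ x^-1)%g (fun g' => X g' x h z)).
transitivity (\sum_g' \sum_k X g' x h k * X g 1%g (h ^ k)%g (k^-1 * z)%g
               * theta w' h k (k^-1 * z)%g).
  by apply: eq_bigr => g' _; rewrite XM theta_1r // mulr1 mulg1.
rewrite exchange_big; apply: eq_bigr => k _.
by rewrite !mulr_suml.
Qed.

(** The image of (eps # x)(eps # y), the sum over g of theta_g(x, y) e_g # xy. *)
Lemma coord_QQ x y h z :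
  \sum_k qm x h k * qm y (h ^ k)%g (k^-1 * z)%g * theta w' h k (k^-1 * z)%g
  = \sum_g theta w g x y * X g (x * y)%g h z.
Proof.
transitivity (\sum_g \sum_g' \sum_k X g x h k * X g' y (h ^ k)%g (k^-1 * z)%g
               * theta w' h k (k^-1 * z)%g).
  under [RHS]eq_bigr => g _ do rewrite exchange_big.
  rewrite exchange_big; apply: eq_bigr => k _.
  rewrite !mulr_suml; apply: eq_bigr => g _.
  by rewrite mulr_sumr mulr_suml.
apply: eq_bigr => g _; rewrite (sum_only (i := (g ^ x)%g)) => [|g' neq].
  by rewrite XM conjgK eqxx mul1r.
by rewrite XM eq_conjV eq_sym (negbTE neq) !mul0r.
Qed.

Lemma coord_QD x h z t z' :
  (z == z')%:R * (qm x (h * t)%g z * gamma w' z h t)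
  = \sum_a \sum_b gamma w x a b * X a x h z * X b x t z'.
Proof.
rewrite /qm mulr_suml mulr_sumr.
rewrite (eq_bigr _ (fun g _ => XD g x h z t z')) [LHS]exchange_big.
rewrite [RHS]exchange_big; apply: eq_bigr => s _.
by rewrite [LHS](reindex_inj (mulIg s)) /=; apply: eq_bigr => a _; rewrite mulgK.
Qed.

End MorphismCoordinates.

(** * Centrality of the associated subgroups and the group map [v] *)

Section Isomorphism.
Variables (K : numFieldType) (gT : finGroupType).
Variables (omega eta : gT -> gT -> gT -> K) (X : gT -> gT -> gT -> gT -> K).
Variables (A B : {group gT}).
Implicit Types (g h x y z s t k b : gT) (w : gT -> gT -> gT -> K).

Hypotheses (cw : cocycle3 omega) (ce : cocycle3 eta).
Hypothesis XH : double_morphism omega eta X.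
Hypothesis Xassoc : forall h z h' z' h'' z'',
  \sum_a \sum_b \sum_c (omega a b c)^-1
     * (X a 1%g h z * X b 1%g h' z' * X c 1%g h'' z'')
  = (z == 1%g)%:R * (z' == 1%g)%:R * (z'' == 1%g)%:R * (eta h h' h'')^-1.
Hypothesis Xfree :
  free_on predT (fun gx (hz : gT * gT) => X gx.1 gx.2 hz.1 hz.2).
(** A weak form of surjectivity: no coordinate functional vanishes on the image. *)
Hypothesis Xsurj : forall h z, exists g x, X g x h z != 0.
Hypotheses (abA : abelian A) (abB : abelian B).
Hypothesis p_outA : forall g z, g \notin A -> X g 1%g 1%g z = 0.
Hypothesis p_outB : forall g z, z \notin B -> X g 1%g 1%g z = 0.
Hypothesis p_free : free_on A (fun g z => X g 1%g 1%g z).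
Hypothesis p_surj : forall b, b \in B ->
  exists c : gT -> K, forall z, \sum_g c g * X g 1%g 1%g z = (z == b)%:R.

Let XM := let: And4 e _ _ _ := XH in e.
Let X1 := let: And4 _ e _ _ := XH in e.
Let XD := let: And4 _ _ e _ := XH in e.
Let X0 := let: And4 _ _ _ e := XH in e.

(* um g h = u(e_g)(h) = the coefficient of e_g in u*(h). *)
Definition um g h := \sum_z X g 1%g h z.

Let Pfree : free_on predT (fun g (hz : gT * gT) => X g 1%g hz.1 hz.2).
Proof.
move=> c c0 g _.
pose d (gx : gT * gT) := c gx.1 * (gx.2 == 1%g)%:R.
have := Xfree (c := d) _ (i := (g, 1%g)) isT; rewrite /d /= eqxx mulr1; apply.
move=> hz; rewrite -[RHS](c0 hz) sum_pair; apply: eq_bigr => h _ /=.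
rewrite (sum_only (i := 1%g)) ?eqxx ?mulr1 // => x /negbTE neq.
by rewrite neq mulr0 mul0r.
Qed.

Let P_factorl g h z : X g 1%g h z = \sum_s um (g * s^-1)%g h * X s 1%g 1%g z.
Proof.
rewrite (coord_factorl ce XH); apply: eq_bigr => s _.
by rewrite gamma_1 // mul1r.
Qed.

(** The mirror image of [P_factorl], with the two coproduct legs exchanged. Comparing the two is
    what makes [A] central. *)
Lemma P_factor g h z :
  X g 1%g h z = \sum_s um (s^-1 * g)%g h * X s 1%g 1%g z.
Proof.
rewrite (coord_factorr ce XH) (reindex (fun s => s^-1 * g)%g) /=; last first.
  by exists (fun s => g * s^-1)%g => s _; rewrite invMg invgK ?mulgKV ?mulKVg.
apply: eq_bigr => s _.
by rewrite gamma_1 // mul1r invMg invgK mulKVg mulrC.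
Qed.

(** By independence of the p(e_s), s in [A], the two factorizations match termwise, so [um] takes
    the same value at g s^-1 and s^-1 g. Hence e_(g^k) # 1 and e_g # 1 have the same image, and
    injectivity gives g^k = g. *)
Lemma A_central k g : k \in A -> commute k g.
Proof.
move=> Ak.
have um_swap s g' h : s \in A -> um (g' * s^-1)%g h = um (s^-1 * g')%g h.
  move=> As; apply/eqP; rewrite -subr_eq0; apply/eqP.
  pose c s := um (g' * s^-1)%g h - um (s^-1 * g')%g h.
  apply: (p_free (c := c)) As => z; rewrite /c.
  under eq_bigr => t _ do rewrite mulrBl.
  by rewrite sumrB -P_factorl -P_factor subrr.
have PJ h z : X (g ^ k)%g 1%g h z = X g 1%g h z.
  rewrite !P_factorl; apply: eq_bigr => s _.
  have [As|/p_outA->] := boolP (s \in A); last by rewrite !mulr0.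
  congr (_ * _).
  rewrite conjgE -!mulgA -um_swap // -mulgA; congr (um (g * _)%g h).
  by rewrite (centsP abA _ Ak) ?groupV // mulgK.
have eqgk : (g ^ k == g)%g.
  pose c s : K := (s == (g ^ k)%g)%:R - (s == g)%:R.
  have := Pfree (c := c) _ (i := g) isT.
  rewrite /c eqxx [_ == (g ^ k)%g]eq_sym; case: eqP => // _ => E.
  suff /eqP: false%:R - true%:R = 0 :> K by rewrite sub0r oppr_eq0 oner_eq0.
  apply: E => -[h z] /=; under eq_bigr => s _ do rewrite mulrBl.
  by rewrite sumrB !sum_delta PJ subrr.
by rewrite /commute -{1}(eqP eqgk) conjgE mulKVg.
Qed.

(** The coassociator axiom minus the product of three unit axioms. The right-hand side now vanishes
    as soon as one of h, h', h'' is 1, by normalization of [eta]. *)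
Let D_coassoc h z h' z' h'' z'' :
  \sum_a \sum_b \sum_c ((omega a b c)^-1 - 1)
     * (X a 1%g h z * X b 1%g h' z' * X c 1%g h'' z'')
  = (z == 1%g)%:R * (z' == 1%g)%:R * (z'' == 1%g)%:R * ((eta h h' h'')^-1 - 1).
Proof.
rewrite mulrBr mulr1 -Xassoc -(X1 h z) -(X1 h' z') -(X1 h'' z'').
rewrite !mulr_suml -sumrB; apply: eq_bigr => a _.
rewrite -mulrA mulr_suml mulr_sumr -sumrB; apply: eq_bigr => b _.
rewrite !mulr_sumr -sumrB; apply: eq_bigr => c _.
by rewrite mulrBl mul1r !mulrA.
Qed.

(** Setting h = 1 in one leg of [D_coassoc] leaves only p there, whose rows over [A] are
    independent; the other two legs use injectivity on the e_g # 1. *)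
Lemma omega_A k g h : k \in A ->
  [/\ omega k g h = 1, omega g k h = 1 & omega g h k = 1].
Proof.
have inv1 (x : K) : x^-1 - 1 = 0 -> x = 1.
  by move/eqP; rewrite subr_eq0 => /eqP/(canRL invrK)->; rewrite invr1.
move=> Ak; split; apply: inv1.
- apply: (free_on_tens3 (D := fun a b c => (omega a b c)^-1 - 1)
    p_free Pfree Pfree) => // z t2 t3.
  by rewrite D_coassoc cocycle3_1 // invr1 subrr mulr0.
- apply: (free_on_tens3 (D := fun a b c => (omega a b c)^-1 - 1)
    Pfree p_free Pfree) => // t1 z t3.
  by rewrite D_coassoc cocycle3_1 // invr1 subrr mulr0.
- apply: (free_on_tens3 (D := fun a b c => (omega a b c)^-1 - 1)
    Pfree Pfree p_free) => // t1 t2 z.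
  by rewrite D_coassoc cocycle3_1 // invr1 subrr mulr0.
Qed.

Lemma omega_translate : translation_invariant A omega.
Proof.
move=> k a b c Ak.
by apply: (cocycle3_translate cw A_central omega_A).
Qed.

Lemma gamma_A x g k : k \in A -> gamma omega x g k = 1.
Proof.
move=> Ak; rewrite -[k]mulg1.
by rewrite (gamma_translate A_central omega_translate _ _ _ Ak).2 gamma_1r.
Qed.

Lemma theta_A k x y : k \in A -> theta omega k x y = 1.
Proof.
move=> Ak; rewrite -[k]mulg1.
by rewrite (theta_translate A_central omega_translate) ?theta_1.
Qed.

Notation Q := (qm X).

Lemma X_outA g x z : g \notin A -> X g x 1%g z = 0.
Proof.
move=> nAg; rewrite (coord_PQ cw XH) big1 // => k _.
by rewrite p_outA // !mul0r.
Qed.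

(** In [coord_factorl] only s in [A] survives, and there gamma is 1, so after summing over g the
    double sum separates. *)
Lemma Q_split x h z : Q x h z = (\sum_y Q x h y) * Q x 1%g z.
Proof.
rewrite /qm [in RHS]exchange_big /=.
under eq_bigr => g _ do rewrite (coord_factorl ce XH).
rewrite exchange_big mulr_sumr; apply: eq_bigr => s _.
have [As|nAs] := boolP (s \in A); last first.
  by rewrite X_outA // mulr0 big1 // => g _; rewrite mulr0.
rewrite [LHS](reindex_inj (mulIg s)) mulr_suml /=; apply: eq_bigr => g _.
by rewrite mulgK gamma_A // mul1r.
Qed.

(** At h = t = 1 the coproduct axiom loses its phases, as only second indices in [A] contribute. The
    scalars [Q x 1 z] are thus orthogonal idempotents with sum 1: a point mass. *)
Lemma Q_group x : exists y, forall z, Q x 1%g z = (z == y)%:R.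
Proof.
have Q1 : \sum_z Q x 1%g z = 1.
  rewrite exchange_big; under eq_bigr => g _ do rewrite X0.
  by rewrite (sum_only (i := 1%g)) ?eqxx // => g /negbTE->.
have QD z z' : (z == z')%:R * Q x 1%g z = Q x 1%g z * Q x 1%g z'.
  have := coord_QD XH x 1%g z 1%g z'; rewrite mulg1 gamma_1r // mulr1 => ->.
  rewrite mulr_suml; apply: eq_bigr => a _; rewrite mulr_sumr.
  apply: eq_bigr => b _.
  have [Ab|nAb] := boolP (b \in A); last by rewrite (X_outA _ _ nAb) !mulr0.
  by rewrite gamma_A // mul1r.
have [y Qy] : exists y, Q x 1%g y != 0.
  apply/existsP; apply: contraNT (oner_neq0 K) => /existsPn Q0.
  by rewrite -Q1 big1 // => z _; apply/eqP; rewrite -[_ == _]negbK Q0.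
exists y => z; have [->|neq] := eqVneq z y.
  by apply: (mulfI Qy); rewrite -QD eqxx mul1r mulr1.
by apply: (mulIf Qy); rewrite -QD (negbTE neq) !mul0r.
Qed.

Lemma v_exists : exists v : gT -> gT, forall x z, Q x 1%g z = (z == v x)%:R.
Proof. exact: fin_all_exists Q_group. Qed.

Variable v : gT -> gT.
Hypothesis Q_v : forall x z, Q x 1%g z = (z == v x)%:R.

Lemma QE x h z : Q x h z = (\sum_y Q x h y) * (z == v x)%:R.
Proof. by rewrite -Q_v -Q_split. Qed.

(** Read [coord_QQ] at h = 1: only g in [A] contributes, where theta is 1, so the point masses
    multiply without phase. *)
Lemma vM x y : v (x * y)%g = (v x * v y)%g.
Proof.
have := coord_QQ XH x y 1%g (v x * v y)%g.
rewrite (sum_only (i := v x)) => [|k /negbTE neq]; last first.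
  by rewrite Q_v neq !mul0r.
rewrite conj1g !Q_v theta_1 // mulKg !eqxx !mulr1 => E.
suff /esym : (1 : K) = (v x * v y == v (x * y))%g%:R.
  by case: eqP => // _ /eqP; rewrite eq_sym oner_eq0.
rewrite -Q_v -[LHS]/(true%:R) E; apply: eq_bigr => g _.
have [Ag|nAg] := boolP (g \in A); last by rewrite X_outA ?mulr0.
by rewrite theta_A // mul1r.
Qed.

(** For g in [A], centrality makes e_g # 1 and eps # x commute; hence p(e_g) commutes with v(x). *)
Let p_swap g x z :
  X g 1%g 1%g ((v x)^-1 * z)%g = X g 1%g 1%g (z * (v x)^-1)%g.
Proof.
have [Ag|nAg] := boolP (g \in A); last by rewrite !p_outA.
have gx : (g ^ x^-1 = g)%g by rewrite conjgE (A_central _ Ag) mulKg.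
have := coord_QP cw XH g x 1%g z; rewrite gx.
rewrite (sum_only (i := v x)) => [|k /negbTE neq]; last first.
  by rewrite Q_v neq !mul0r.
rewrite conj1g Q_v theta_1 // eqxx mul1r mulr1 => <-.
rewrite (coord_PQ cw XH) (sum_only (i := z * (v x)^-1)%g) => [|k neq].
  by rewrite conj1g Q_v theta_1 // invMg invgK mulgKV eqxx !mulr1.
rewrite conj1g Q_v; case: eqP => [E|]; last by rewrite mulr0 mul0r.
by rewrite -E invMg invgK mulKVg eqxx in neq.
Qed.

Lemma B_central b g : b \in B -> commute b g.
Proof.
move=> Bb.
have vb x b' : b' \in B -> commute b' (v x).
  move=> Bb'; have [c Ec] := p_surj Bb'.
  have : (1 : K) = (v x * b' * (v x)^-1 == b')%g%:R.
    rewrite -Ec; under eq_bigr => a _ do rewrite -p_swap mulKg.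
    by rewrite Ec eqxx.
  case: eqP => [E _|_ /eqP]; last by rewrite oner_eq0.
  by rewrite /commute -{1}E mulgKV.
(* In [coord_PQ] at h = 1 only k = g v(x)^-1 contributes, so a non-zero coefficient puts it in [B]:
   this is G = B v(G). *)
have [g' [x]] := Xsurj 1%g g.
have [Bg|nBg] := boolP (g * (v x)^-1 \in B)%g.
  move=> _; rewrite -[g](mulgKV (v x)); apply: commuteM; last exact: vb.
  exact: (centsP abB).
rewrite (coord_PQ cw XH) (sum_only (i := g * (v x)^-1)%g) => [|k neq].
  by rewrite p_outB // !mul0r eqxx.
rewrite conj1g Q_v; case: eqP => [E|]; last by rewrite mulr0 mul0r.
by rewrite -E invMg invgK mulKVg eqxx in neq.
Qed.

Lemma p_mul g g' z :
  \sum_k X g 1%g 1%g k * X g' 1%g 1%g (k^-1 * z)%g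
  = (g == g')%:R * X g 1%g 1%g z.
Proof.
have := XM g 1%g g' 1%g 1%g z.
rewrite invg1 conjg1 mul1g theta_1r // mulr1 => <-.
by apply: eq_bigr => k _; rewrite conj1g theta_1 // mulr1.
Qed.

(** As b is grouplike, p (x) p kills the coproduct of c minus c (x) c. Independence over [A] in both
    legs makes c a character of [A]. *)
Lemma chi_mul (c : gT -> K) b :
  (forall z, \sum_g c g * X g 1%g 1%g z = (z == b)%:R) ->
  {in A &, forall k l, c (k * l)%g = c k * c l}.
Proof.
move=> cb k l Ak Al; apply/eqP; rewrite -subr_eq0; apply/eqP.
apply: (p_free (c := fun l => c (k * l)%g - c k * c l)) Al => z'.
rewrite -[LHS]/((fun k => \sum_l (c (k * l)%g - c k * c l) * X l 1%g 1%g z') k).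
apply: p_free Ak => z.
under eq_bigr => g _ do rewrite mulr_suml.
rewrite exchange_big.
transitivity (\sum_s \sum_g c g * (X (g * s^-1)%g 1%g 1%g z * X s 1%g 1%g z')
   - (\sum_g c g * X g 1%g 1%g z) * (\sum_s c s * X s 1%g 1%g z')).
  rewrite mulr_sumr -sumrB; apply: eq_bigr => s _.
  rewrite [X in _ = X - _](reindex_inj (mulIg s)) /= mulr_suml -sumrB.
  by apply: eq_bigr => g _; rewrite mulgK; ring.
rewrite exchange_big !cb.
have E g : \sum_s X (g * s^-1)%g 1%g 1%g z * X s 1%g 1%g z'
    = (z == z')%:R * X g 1%g 1%g z.
  have := XD g 1%g 1%g z 1%g z'; rewrite mulg1 gamma_1r // mulr1 => ->.
  by apply: eq_bigr => s _; rewrite gamma_1 // mul1r.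
under eq_bigr => g _ do rewrite -mulr_sumr E mulrCA.
rewrite -mulr_sumr cb eq_sym.
case: (eqVneq z b) => [->|_]; last by rewrite mulr0 mul0r subrr.
by rewrite mulr1 mul1r subrr.
Qed.

(** p is multiplicative, so it sends c c' to b b^-1 = 1, as it does the constant function 1;
    independence over [A] concludes. *)
Lemma chi_inv (c c' : gT -> K) b k :
  (forall z, \sum_g c g * X g 1%g 1%g z = (z == b)%:R) ->
  (forall z, \sum_g c' g * X g 1%g 1%g z = (z == b^-1)%g%:R) ->
  k \in A -> c k * c' k = 1.
Proof.
move=> cb cb' Ak; apply/eqP; rewrite -subr_eq0; apply/eqP.
apply: (p_free (c := fun k => c k * c' k - 1)) Ak => z.
under eq_bigr => g _ do rewrite mulrBl mul1r.
rewrite sumrB X1.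
transitivity (\sum_l (\sum_g c g * X g 1%g 1%g l)
     * (\sum_g c' g * X g 1%g 1%g (l^-1 * z)%g) - (z == 1%g)%:R).
  congr (_ - _); under [RHS]eq_bigr => l _ do rewrite big_distrlr.
  rewrite exchange_big; apply: eq_bigr => g _.
  rewrite exchange_big (sum_only (i := g)) => [|g' neq].
    have -> : X g 1%g 1%g z = \sum_l X g 1%g 1%g l * X g 1%g 1%g (l^-1 * z)%g.
      by rewrite p_mul eqxx mul1r.
    rewrite mulr_sumr.
    by apply: eq_bigr => l _ /=; ring.
  transitivity (c g * c' g' * \sum_l X g 1%g 1%g l * X g' 1%g 1%g (l^-1 * z)%g).
    by rewrite mulr_sumr; apply: eq_bigr => l _ /=; ring.
  by rewrite p_mul eq_sym (negbTE neq) mul0r mulr0.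
rewrite (sum_only (i := b)) => [|l /negbTE neq]; last by rewrite cb neq mul0r.
rewrite cb cb' eqxx mul1r -[(_ == _^-1)%g](inj_eq (mulgI b)) mulKVg mulgV.
by rewrite subrr.
Qed.

End Isomorphism.

(** * Phases and rigidity *)

Section SplitMorphism.
Variables (K : numFieldType) (gT : finGroupType).
Variables (X : gT -> gT -> gT -> gT -> K) (v : gT -> gT) (A B : {group gT}).
Implicit Types (g h x y z s t k b : gT) (w : gT -> gT -> gT -> K) (f : gT -> K).

Notation Q := (qm X).
(* rm x h = r(x)(h), and uf f = u(f). *)
Definition rm x h := \sum_z Q x h z.
Definition uf f h := \sum_g f g * um X g h.

Hypothesis A_central : forall k g, k \in A -> commute k g.
Hypothesis B_central : forall b g, b \in B -> commute b g.
Hypothesis p_outA : forall g z, g \notin A -> X g 1%g 1%g z = 0.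
Hypothesis p_outB : forall g z, z \notin B -> X g 1%g 1%g z = 0.
Hypothesis P_factor : forall g h z,
  X g 1%g h z = \sum_s um X (s^-1 * g)%g h * X s 1%g 1%g z.
Hypothesis X1 : forall h z, \sum_g X g 1%g h z = (z == 1%g)%:R.
Hypothesis QE : forall x h z, Q x h z = rm x h * (z == v x)%:R.
Hypothesis vM : forall x y, v (x * y)%g = (v x * v y)%g.

Let B_conj b h : b \in B -> (h ^ b = h)%g.
Proof. by move=> Bb; rewrite conjgE -(B_central h Bb) mulKg. Qed.

Lemma P_outB g h z : z \notin B -> X g 1%g h z = 0.
Proof.
by move=> nBz; rewrite P_factor big1 // => s _; rewrite p_outB // mulr0.
Qed.

Lemma uf_1 h : uf (fun=> 1) h = 1.
Proof.
rewrite /uf; under eq_bigr => g _ do rewrite mul1r.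
rewrite exchange_big; under eq_bigr => z _ do rewrite X1.
by rewrite (sum_only (i := 1%g)) ?eqxx // => z /negbTE->.
Qed.

Lemma rm_1 h : rm 1%g h = 1.
Proof.
rewrite /rm; under eq_bigr => z _ do rewrite /qm X1.
by rewrite (sum_only (i := 1%g)) ?eqxx // => z /negbTE->.
Qed.

(* f # 1 is sent to u(f) # b; this holds when f is a b-eigenfunction for the
   translations by A, under the identification of B with the dual of A. *)
Definition homogeneous f b : Prop :=
  forall h z, \sum_g f g * X g 1%g h z = uf f h * (z == b)%:R.

(** Substituting s g for g in [P_factor] pulls out c(s), and the two sums separate into u(f) and
    p(c) = b. *)
Lemma eigen_homogeneous f (c : gT -> K) b :
  (forall z, \sum_g c g * X g 1%g 1%g z = (z == b)%:R) ->
  (forall k g, k \in A -> f (k * g)%g = c k * f g) ->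
  homogeneous f b.
Proof.
move=> cb fA h z; rewrite -cb mulr_sumr.
under eq_bigr => g _ do rewrite P_factor mulr_sumr.
rewrite exchange_big; apply: eq_bigr => s _.
have [As|nAs] := boolP (s \in A); last first.
  by rewrite !p_outA // !mulr0 big1 // => g _; rewrite !mulr0.
rewrite [LHS](reindex_inj (mulgI s)) mulr_suml /=; apply: eq_bigr => g _.
by rewrite mulKg fA //; ring.
Qed.

Lemma invariant_homogeneous f :
  (forall k g, k \in A -> f (k * g)%g = f g) -> homogeneous f 1%g.
Proof.
move=> fA; apply: (eigen_homogeneous (c := fun=> 1)) => [z|k g Ak].
  by under eq_bigr => g _ do rewrite mul1r; exact: X1.
by rewrite fA // mul1r.
Qed.

(** * Identities for an arbitrary pair of cocycles sharing the array [X] *)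

Section Morphism.
Variables w w' : gT -> gT -> gT -> K.
Hypotheses (cw : cocycle3 w) (cw' : cocycle3 w').
Hypotheses (XH : double_morphism w w' X) (wA : translation_invariant A w).

(** Compares the images of (f # 1)(f' # 1) = f f' # 1; on the product side only the coefficient at b
    b' survives. *)
Lemma uf_mul f f' b b' h : b \in B -> homogeneous f b -> homogeneous f' b' ->
  uf f h * uf f' h * theta w' h b b' = uf (fun g => f g * f' g) h.
Proof.
move=> Bb fb fb'; have [XM _ _ _] := XH.
transitivity (\sum_z \sum_k (\sum_g f g * X g 1%g h k)
    * (\sum_g f' g * X g 1%g (h ^ k)%g (k^-1 * z)%g) * theta w' h k (k^-1 * z)%g).
  rewrite (sum_only (i := b * b')%g) => [|z neq].
    rewrite (sum_only (i := b)) => [|k /negbTE neq].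
      by rewrite fb fb' mulKg !eqxx !mulr1 B_conj.
    by rewrite fb neq mulr0 !mul0r.
  rewrite big1 // => k _; rewrite fb fb'.
  have [->|] := eqVneq k b; last by rewrite mulr0 !mul0r.
  have [E|] := eqVneq (b^-1 * z)%g b'; last by rewrite !mulr0 mul0r.
  by rewrite -E mulKVg eqxx in neq.
rewrite /uf; under [RHS]eq_bigr => g _ do rewrite mulr_sumr.
rewrite [RHS]exchange_big; apply: eq_bigr => z _.
transitivity (\sum_g \sum_g' \sum_k f g * f' g'
  * (X g 1%g h k * X g' 1%g (h ^ k)%g (k^-1 * z)%g * theta w' h k (k^-1 * z)%g)).
  under [RHS]eq_bigr => g _ do rewrite exchange_big.
  rewrite [RHS]exchange_big; apply: eq_bigr => k _.
  rewrite big_distrlr mulr_suml /=; apply: eq_bigr => g _.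
  by rewrite mulr_suml; apply: eq_bigr => g' _; ring.
apply: eq_bigr => g _; rewrite (sum_only (i := g)) => [|g' neq].
  by rewrite -mulr_sumr XM invg1 conjg1 eqxx theta_1r // mulg1 !mul1r.
rewrite -mulr_sumr XM invg1 conjg1 eq_sym (negbTE neq).
by rewrite !mul0r mulr0.
Qed.

Lemma coord_homogeneous_PQ f b x h z : b \in B -> homogeneous f b ->
  \sum_g f g * X g x h z
  = uf f h * rm x h * theta w' h b (v x) * (z == b * v x)%g%:R.
Proof.
move=> Bb fb.
transitivity (\sum_k (\sum_g f g * X g 1%g h k) * Q x (h ^ k)%g (k^-1 * z)%g
                * theta w' h k (k^-1 * z)%g).
  under eq_bigr => g _ do rewrite (coord_PQ cw XH) mulr_sumr.
  rewrite exchange_big; apply: eq_bigr => k _ /=.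
  by rewrite !mulr_suml; apply: eq_bigr => g _; ring.
rewrite (sum_only (i := b)) => [|k /negbTE neq]; last first.
  by rewrite fb neq mulr0 !mul0r.
rewrite fb eqxx mulr1 B_conj // QE -(inj_eq (mulgI b)) mulKVg.
have [->|_] := eqVneq z (b * v x)%g; last by rewrite !mulr0 mul0r.
by rewrite mulKg !mulr1.
Qed.

Lemma coord_homogeneous_QP f b x h : homogeneous f b ->
  \sum_g f g * X (g ^ x^-1)%g x h (v x * b)%g
  = rm x h * uf f (h ^ v x)%g * theta w' h (v x) b.
Proof.
move=> fb.
transitivity (\sum_k Q x h k * (\sum_g f g * X g 1%g (h ^ k)%g (k^-1 * (v x * b))%g)
                * theta w' h k (k^-1 * (v x * b))%g).
  under eq_bigr => g _ do rewrite (coord_QP cw XH) mulr_sumr.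
  rewrite exchange_big; apply: eq_bigr => k _ /=.
  by rewrite mulr_sumr !mulr_suml; apply: eq_bigr => g _; ring.
rewrite (sum_only (i := v x)) => [|k /negbTE neq]; last first.
  by rewrite QE neq mulr0 !mul0r.
by rewrite QE fb mulKg !eqxx !mulr1.
Qed.

(** The function sending g to theta_g(x, y) is invariant under [A], hence homogeneous of degree 1,
    so the right side of [coord_QQ] collapses to one product. *)
Lemma rm_mul x y h : rm x h * rm y (h ^ v x)%g * theta w' h (v x) (v y)
  = uf (fun g => theta w g x y) h * rm (x * y)%g h.
Proof.
transitivity (\sum_g theta w g x y * X g (x * y)%g h (v x * v y)%g).
  rewrite -(coord_QQ XH) (sum_only (i := v x)) => [|k /negbTE neq].
    by rewrite !QE mulKg !eqxx !mulr1.
  by rewrite QE neq mulr0 !mul0r.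
rewrite (coord_homogeneous_PQ (b := 1%g)) //; last first.
  by apply: invariant_homogeneous => k g Ak; rewrite (theta_translate A_central wA).
by rewrite mul1g vM theta_1l // eqxx !mulr1.
Qed.

(** Here gamma_x is invariant under [A] in each argument, so [coord_homogeneous_PQ] applies to each
    leg of the coproduct in turn. *)
Lemma rm_comul x h t : rm x (h * t)%g * gamma w' (v x) h t
  = (\sum_a \sum_b um X a h * um X b t * gamma w x a b) * (rm x h * rm x t).
Proof.
have [gl gr] : (forall b, homogeneous (fun a => gamma w x a b) 1%g)
    /\ homogeneous (fun b => uf (fun a => gamma w x a b) h) 1%g.
  split=> [b|]; apply: invariant_homogeneous => k g Ak.
    exact: (gamma_translate A_central wA _ _ _ Ak).1.
  by apply: eq_bigr => a _; rewrite (gamma_translate A_central wA _ _ _ Ak).2.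
have := coord_QD XH x h (v x) t (v x).
rewrite eqxx mul1r QE eqxx mulr1 => ->.
rewrite exchange_big /=.
transitivity (\sum_b uf (fun a => gamma w x a b) h * X b x t (v x) * rm x h).
  apply: eq_bigr => b _; rewrite -mulr_suml.
  rewrite (coord_homogeneous_PQ _ _ _ (group1 B) (gl b)) //.
  by rewrite mul1g theta_1l // eqxx !mulr1; ring.
rewrite -mulr_suml (coord_homogeneous_PQ _ _ _ (group1 B) gr) // mul1g theta_1l // eqxx.
rewrite !mulr1 exchange_big /= -mulrA [rm x t * _]mulrC; congr (_ * _).
apply: eq_bigr => b _; rewrite mulr_suml; apply: eq_bigr => a _.
ring.
Qed.

(** The right-hand side contains no phase, because gamma_1 is trivial; it is therefore common to all
    pairs of cocycles for which [X] is a morphism. *)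
Lemma uf_comul f b h t : homogeneous f b ->
  uf f (h * t)%g * gamma w' b h t
  = \sum_g f g * \sum_s X (g * s^-1)%g 1%g h b * X s 1%g t b.
Proof.
move=> fb; have [_ _ XD _] := XH.
have -> : uf f (h * t)%g = \sum_g f g * X g 1%g (h * t)%g b.
  by rewrite fb eqxx mulr1.
rewrite mulr_suml; apply: eq_bigr => g _; rewrite -mulrA; congr (_ * _).
have := XD g 1%g h b t b; rewrite eqxx mul1r => ->.
by apply: eq_bigr => s _; rewrite gamma_1 // mul1r.
Qed.

Lemma uf_neq0 f f' b b' h : b \in B -> homogeneous f b -> homogeneous f' b' ->
  (forall g, f g * f' g = 1) -> uf f h != 0.
Proof.
move=> Bb fb fb' ff'; apply: contraNneq (oner_neq0 K) => uf0.
rewrite -(uf_1 h) -[X in X == _](_ : uf (fun g => f g * f' g) h = _); last first.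
  by apply: eq_bigr => g _; rewrite ff'.
by rewrite -(uf_mul _ Bb fb fb') uf0 !mul0r.
Qed.

(** With y = x^-1, the right side of [rm_mul] is u of the invertible invariant function theta(., x,
    x^-1), non-zero by [uf_neq0]. *)
Lemma rm_neq0 x h : rm x h != 0.
Proof.
have thA y k g : k \in A -> theta w (k * g)%g x y = theta w g x y.
  exact: (theta_translate A_central wA).
have : uf (fun g => theta w g x x^-1%g) h != 0.
  apply: (uf_neq0 (f' := fun g => (theta w g x x^-1%g)^-1) (b := 1%g) (b' := 1%g)).
  - exact: group1.
  - by apply: invariant_homogeneous => k g Ak; rewrite thA.
  - by apply: invariant_homogeneous => k g Ak; rewrite thA.
  - by move=> g; rewrite mulfV // theta_neq0.
apply: contraNneq => rx0; have := rm_mul x x^-1%g h.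
by rewrite rx0 !mul0r mulgV rm_1 mulr1 => <-.
Qed.

End Morphism.

(** * Equivalence of rigidity with the conditions on the phases *)

Section Rigidity.
Variables omega eta : gT -> gT -> gT -> K.
Hypotheses (cw : cocycle3 omega) (ce : cocycle3 eta).
Hypotheses (XH : double_morphism omega eta X).
Hypothesis wA : translation_invariant A omega.
Hypothesis eigen : forall b, b \in B -> exists f f' b',
  [/\ homogeneous f b, homogeneous f' b' & forall g, f g * f' g = 1].

Let w1 : gT -> gT -> gT -> K := fun _ _ _ => 1.
Let cw1 : cocycle3 w1 := cocycle3_trivial K gT.
Let w1A : translation_invariant A w1. Proof. by []. Qed.

(** Conditions 2 and 3, the mixed part of condition 4, its part on B x B, and condition 5, with [v]
    a map of group elements. Applying [uf] to theta(., g, h) is the linear extension of theta to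
    u*(x). *)
Definition phase_conditions : Prop :=
  [/\ forall g x y, \sum_a \sum_b um X a x * um X b y * gamma omega g a b
                    = gamma eta (v g) x y,
      forall g h x, uf (fun k => theta omega k g h) x = theta eta x (v g) (v h),
      forall x b g, b \in B -> theta eta x b (v g) = 1 /\ theta eta x (v g) b = 1,
      forall x b b', b \in B -> b' \in B -> theta eta x b b' = 1
    & forall b x y, b \in B -> gamma eta b x y = 1].

(** Each identity holds both with the given phases and with trivial ones; dividing the two by their
    common non-zero coefficients isolates the phases. *)
Lemma rigid_phase_conditions : double_morphism w1 w1 X -> phase_conditions.
Proof.
move=> X1H; have rx0 := rm_neq0 cw ce XH wA.
split.
- move=> g x y; have := rm_comul cw1 cw1 X1H w1A g x y.
  have -> : \sum_a \sum_b um X a x * um X b y * gamma w1 g a b = 1.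
    transitivity (uf (fun=> 1) x * uf (fun=> 1) y); last by rewrite !uf_1 mulr1.
    rewrite big_distrlr.
    apply: eq_bigr => a _; apply: eq_bigr => b _.
    by rewrite gamma_trivial !mul1r mulr1.
  rewrite gamma_trivial mulr1 mul1r => rD.
  have := rm_comul cw ce XH wA g x y; rewrite rD mulrC.
  by move/(mulIf (mulf_neq0 (rx0 _ _) (rx0 _ _))).
- move=> g h x; have := rm_mul cw1 cw1 X1H w1A g h x.
  rewrite theta_trivial mulr1 => rM.
  have := rm_mul cw ce XH wA g h x; rewrite rM.
  have -> : uf (fun k => theta w1 k g h) x = 1.
    by rewrite -(uf_1 x); apply: eq_bigr => k _; rewrite theta_trivial.
  by rewrite mul1r mulrC => /(mulIf (rx0 _ _)).
- move=> x b g Bb; have [f [f' [b' [fb fb' ff']]]] := eigen Bb.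
  have ux0 h := uf_neq0 cw XH h Bb fb fb' ff'.
  split.
    have := coord_homogeneous_PQ cw1 X1H g x (b * v g)%g Bb fb.
    rewrite (coord_homogeneous_PQ cw XH _ _ _ Bb fb) eqxx theta_trivial !mulr1.
    by rewrite -[RHS]mulr1 => /(mulfI (mulf_neq0 (ux0 _) (rx0 _ _))).
  have := coord_homogeneous_QP cw1 X1H g x fb.
  rewrite (coord_homogeneous_QP cw XH _ _ fb) theta_trivial.
  by move/(mulfI (mulf_neq0 (rx0 _ _) (ux0 _))).
- move=> x b b' Bb Bb'; have [f [f1 [b1 [fb fb1 ff1]]]] := eigen Bb.
  have [f' [f2 [b2 [fb' fb2 ff2]]]] := eigen Bb'.
  have ux0 := uf_neq0 cw XH x Bb fb fb1 ff1.
  have ux0' := uf_neq0 cw XH x Bb' fb' fb2 ff2.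
  have := uf_mul cw1 X1H x Bb fb fb'; rewrite -(uf_mul cw XH x Bb fb fb').
  by rewrite theta_trivial => /(mulfI (mulf_neq0 ux0 ux0')).
- move=> b x y Bb; have [f [f1 [b1 [fb fb1 ff1]]]] := eigen Bb.
  have ux0 := uf_neq0 cw XH (x * y)%g Bb fb fb1 ff1.
  have := uf_comul cw1 X1H x y fb; rewrite -(uf_comul cw XH x y fb).
  by rewrite gamma_trivial => /(mulfI ux0).
Qed.

Lemma phase_conditions_rigid : phase_conditions -> double_morphism w1 w1 X.
Proof.
case=> c2 c3 c4v c4b c5; have rx0 := rm_neq0 cw ce XH wA.
have [XM _ XD X0] := XH.
(* Condition 4 removes the phase from [coord_PQ], where only k = z v(x)^-1 contributes. *)
have XE g x h z : X g x h z = X g 1%g h (z * (v x)^-1)%g * rm x h.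
  rewrite (coord_PQ cw XH) (sum_only (i := z * (v x)^-1)%g) => [|k neq].
    have [Bz|nBz] := boolP (z * (v x)^-1 \in B)%g; last first.
      by rewrite P_outB // !mul0r.
    by rewrite B_conj // invMg invgK mulgKV (c4v _ _ _ Bz).1 mulr1 QE eqxx mulr1.
  rewrite QE; case: eqP => [E|]; last by rewrite !mulr0 mul0r.
  by rewrite -E invMg invgK mulKVg eqxx in neq.
have PM g g' h z : \sum_k X g 1%g h k * X g' 1%g h (k^-1 * z)%g
    = (g == g')%:R * X g 1%g h z.
  have := XM g 1%g g' 1%g h z.
  rewrite invg1 conjg1 mul1g theta_1r // mulr1 => <-; apply: eq_bigr => k _.
  have [Bk|nBk] := boolP (k \in B); last by rewrite P_outB // !mul0r.
  rewrite B_conj //.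
  have [Bz|nBz] := boolP (k^-1 * z \in B)%g; first by rewrite c4b // mulr1.
  by rewrite (P_outB _ _ nBz) !mulr0 mul0r.
(* One coefficient of the image of e_(x g x^-1) # x, computed with the factors in both orders. *)
have QP x g h z : rm x h * X g 1%g (h ^ v x)%g z
    = X (g ^ x^-1)%g 1%g h (v x * z * (v x)^-1)%g * rm x h.
  rewrite -XE (coord_QP cw XH) (sum_only (i := v x)) => [|k /negbTE neq].
    rewrite QE eqxx mulr1 mulKg.
    have [Bz|nBz] := boolP (z \in B); first by rewrite (c4v _ _ _ Bz).2 mulr1.
    by rewrite (P_outB _ _ nBz) !mulr0 mul0r.
  by rewrite QE neq mulr0 !mul0r.
(* Condition 3 makes the phases on the two sides of [rm_mul] equal; condition 2 does the same below
   for [rm_comul]. *)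
have rM x y h : rm x h * rm y (h ^ v x)%g = rm (x * y)%g h.
  have := rm_mul cw ce XH wA x y h; rewrite c3 mulrC.
  by move/(mulfI (theta_neq0 ce _ _ _)).
have rD x h t : rm x (h * t)%g = rm x h * rm x t.
  have := rm_comul cw ce XH wA x h t; rewrite c2 mulrC.
  by move/(mulfI (gamma_neq0 ce _ _ _)).
split=> // [g x g' y h z | g x h z t z'].
- rewrite theta_trivial mulr1.
  under eq_bigr => k _ do rewrite theta_trivial mulr1.
  (* After this shift [QP] brings the two e_g # 1 parts together, to be multiplied by [PM], and
     leaves the r parts to [rM]. *)
  rewrite (reindex_inj (mulIg (v x))) /=.
  transitivity (\sum_k X g 1%g h k * X (g' ^ x^-1)%g 1%g h
      (k^-1 * (z * (v (x * y))^-1))%g * (rm x h * rm y (h ^ v x)%g)).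
    apply: eq_bigr => k _; rewrite (XE g x) (XE g' y) mulgK.
    have [Bk|nBk] := boolP (k \in B); last by rewrite P_outB // !mul0r.
    rewrite conjgM (B_conj _ Bk).
    transitivity (X g 1%g h k * rm y (h ^ v x)%g * (rm x h
        * X g' 1%g (h ^ v x)%g ((k * v x)^-1 * z * (v y)^-1)%g)); first by ring.
    by rewrite QP vM !invMg !mulgA mulgV mul1g; ring.
  by rewrite -mulr_suml PM rM (XE g (x * y)%g) mulrA.
- rewrite gamma_trivial mulr1 (XE g x) rD.
  transitivity ((z == z')%:R * X g 1%g (h * t)%g (z * (v x)^-1)%g
                * (rm x h * rm x t)); first by ring.
  have -> : (z == z')%:R * X g 1%g (h * t)%g (z * (v x)^-1)%g
      = \sum_s X (g * s^-1)%g 1%g h (z * (v x)^-1)%g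
              * X s 1%g t (z' * (v x)^-1)%g.
    have [Bz|nBz] := boolP (z * (v x)^-1 \in B)%g; last first.
      by rewrite P_outB // mulr0 big1 // => s _; rewrite P_outB ?mul0r.
    have := XD g 1%g h (z * (v x)^-1)%g t (z' * (v x)^-1)%g.
    rewrite (inj_eq (mulIg _)) c5 // mulr1 => ->.
    by apply: eq_bigr => s _; rewrite gamma_1 // mul1r.
  rewrite mulr_suml; apply: eq_bigr => s _.
  by rewrite gamma_trivial (XE _ x h) (XE s x); ring.
Qed.

End Rigidity.
End SplitMorphism.

(** * Components, phases and subgroups in coordinates *)

(** A character of [A] extends to an eigenfunction on G through chosen representatives of the right
    cosets: g and k g share theirs, and g repr(Ag)^-1 lies in [A]. *)
Lemma eigenfunction_extend (K : numFieldType) (gT : finGroupType)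
    (A : {group gT}) (c : gT -> K) :
  {in A &, forall k l, c (k * l)%g = c k * c l} ->
  forall k g, k \in A ->
  c (k * g * (repr (A :* (k * g)))^-1)%g
  = c k * c (g * (repr (A :* g))^-1)%g.
Proof.
move=> cM k g Ak; rewrite rcosetM rcoset_id // -mulgA cM //.
by rewrite -mem_rcoset rcoset_repr rcoset_refl.
Qed.

(** The cocycle on the quotient is evaluated at coset representatives; invariance makes the choice
    irrelevant. *)
Lemma translation_invariant_quo (K : numFieldType) (gT : finGroupType)
    (A : {group gT}) (w : gT -> gT -> gT -> K) :
  (forall k g, k \in A -> commute k g) -> cocycle3 w ->
  translation_invariant A w -> cocycle3_quo A w.
Proof.
move=> cA [wn w1 wM] wA.
have nA g : g \in 'N(A)%g.
  by apply: (subsetP (cent_sub A)); apply/centP => k Ak; apply/esym/cA.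
pose w' (x y z : coset_of A) := w (repr x) (repr y) (repr z).
have reprE g : exists2 k, k \in A & repr (coset A g) = (k * g)%g.
  have : repr (coset A g) \in (A :* g)%g.
    by rewrite -val_coset ?nA // mem_repr_coset.
  by case/rcosetP => k Ak ->; exists k.
have w'E a b c : w' (coset A a) (coset A b) (coset A c) = w a b c.
  rewrite /w'; have [k Ak ->] := reprE a; have [l Al ->] := reprE b.
  have [m Am ->] := reprE c.
  have [-> _ _] := wA k a (l * b)%g (m * c)%g Ak.
  have [_ -> _] := wA l a b (m * c)%g Al.
  by have [_ _ ->] := wA m a b c Am.
have cosetE (x : coset_of A) : exists g, x = coset A g.
  by exists (repr x); rewrite coset_reprK.
exists w' => [|a b c]; last by rewrite w'E.
split=> [x y z|x y|x y z t].
- exact: wn.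
- have [g ->] := cosetE x; have [h ->] := cosetE y.
  by rewrite -(morph1 (coset A)) w'E w1.
have [a ->] := cosetE x; have [b ->] := cosetE y.
have [c ->] := cosetE z; have [d ->] := cosetE t.
by rewrite -!morphM ?nA // !w'E wM.
Qed.

Section Components.
Variables (K : numFieldType) (gT : finGroupType).
Variable psi : {linear fvect K (gT * gT)%type -> fvect K (gT * gT)%type}.
Implicit Types (g h x y z : gT).

Notation X := (dcoord psi).

Lemma psi_tens_one (f : fvect K gT) h z :
  psi (tens f (bone (groupalg K gT))) (h, z) = \sum_g f g * X g 1%g h z.
Proof.
rewrite dcoordE; apply: eq_bigr => g _.
rewrite (sum_only (i := 1%g)) => [|x /negbTE neq]; rewrite !ffunE /=.
  by rewrite eqxx mulr1.
by rewrite neq mulr0 mul0r.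
Qed.

Lemma psi_one_tens (y : fvect K gT) h z :
  psi (tens (bone (dualalg K gT)) y) (h, z)
  = \sum_x y x * \sum_g X g x h z.
Proof.
rewrite dcoordE exchange_big; apply: eq_bigr => x _; rewrite mulr_sumr.
by apply: eq_bigr => g _; rewrite !ffunE /= mul1r.
Qed.

Lemma comp_pE (f : fvect K gT) z : comp_p psi f z = \sum_g f g * X g 1%g 1%g z.
Proof. by rewrite -psi_tens_one !ffunE /= ffunE. Qed.

Lemma comp_uE g h : comp_u psi (bas K g) h = um X g h.
Proof.
rewrite ffunE /=; apply: eq_bigr => z _; rewrite ffunE psi_tens_one.
by under eq_bigr => g' _ do rewrite basE; rewrite sum_delta.
Qed.

Lemma comp_vE x z : comp_v psi (bas K x) z = qm X x 1%g z.
Proof.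
rewrite !ffunE /= ffunE psi_one_tens.
by under eq_bigr => y _ do rewrite basE; rewrite sum_delta.
Qed.

Lemma dual_comp_uE x g : dual_map (comp_u psi) (bas K x) g = um X g x.
Proof.
rewrite ffunE -comp_uE -(sum_delta x (comp_u psi (bas K g))).
by apply: eq_bigr => h _; rewrite basE mulrC.
Qed.

Lemma coassocE (w : gT -> gT -> gT -> K) a x b y c z :
  coassoc (tdouble w) ((a, x), (b, y), (c, z))
  = (x == 1%g)%:R * (y == 1%g)%:R * (z == 1%g)%:R * (w a b c)^-1.
Proof.
rewrite /= sum_ffunE (sum_only (i := a)) => [|a' neq].
  rewrite sum_ffunE (sum_only (i := b)) => [|b' neq].
    rewrite sum_ffunE (sum_only (i := c)) => [|c' neq].
      by rewrite scale_basE !xpair_eqE !eqxx /= -!mulnb !natrM; ring.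
    by rewrite scale_basE !xpair_eqE (eq_sym c) (negbTE neq) andbF mulr0.
  rewrite sum_ffunE big1 // => c' _.
  by rewrite scale_basE !xpair_eqE (eq_sym b) (negbTE neq) andbF mulr0.
rewrite sum_ffunE big1 // => b' _; rewrite sum_ffunE big1 // => c' _.
by rewrite scale_basE !xpair_eqE (eq_sym a) (negbTE neq) mulr0.
Qed.

Lemma tens_map_bas (I J I' J' : finType) (F : fvect K I -> fvect K I')
    (G : fvect K J -> fvect K J') i j i' j' :
  tens_map F G (bas K (i, j)) (i', j') = F (bas K i) i' * G (bas K j) j'.
Proof.
rewrite tens_mapE (sum_only (i := i)) => [|k /negbTE neq].
  rewrite (sum_only (i := j)) => [|l /negbTE neq].
    by rewrite basE eqxx mul1r.
  by rewrite basE xpair_eqE neq andbF mul0r.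
by rewrite big1 // => l _; rewrite basE xpair_eqE neq mul0r.
Qed.

Lemma tens_map_coassoc (w : gT -> gT -> gT -> K) h z h' z' h'' z'' :
  tens_map (tens_map psi psi) psi (coassoc (tdouble w))
    ((h, z), (h', z'), (h'', z''))
  = \sum_a \sum_b \sum_c (w a b c)^-1
      * (X a 1%g h z * X b 1%g h' z' * X c 1%g h'' z'').
Proof.
rewrite tens_mapE !sum_pair; apply: eq_bigr => a _.
rewrite (sum_only (i := 1%g)) => [|x /negbTE neq]; last first.
  rewrite sum_pair big1 // => b _; rewrite big1 // => y _.
  rewrite sum_pair big1 // => c _; rewrite big1 // => t _.
  by rewrite coassocE neq !mul0r.
rewrite sum_pair; apply: eq_bigr => b _.
rewrite (sum_only (i := 1%g)) => [|y /negbTE neq]; last first.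
  rewrite sum_pair big1 // => c _; rewrite big1 // => t _.
  by rewrite coassocE neq mulr0 !mul0r.
rewrite sum_pair; apply: eq_bigr => c _.
rewrite (sum_only (i := 1%g)) => [|t /negbTE neq]; last first.
  by rewrite coassocE neq mulr0 !mul0r.
by rewrite coassocE !eqxx !mul1r tens_map_bas.
Qed.

Lemma trilinear_bas1 (t : gT -> gT -> gT -> K) i (a b : fvect K gT) :
  trilinear t (bas K i) a b = \sum_j \sum_k a j * b k * t i j k.
Proof.
rewrite /trilinear (sum_only (i := i)) => [|j /negbTE neq].
  by apply: eq_bigr => j _; apply: eq_bigr => k _; rewrite basE eqxx mul1r.
by rewrite big1 // => k _; rewrite big1 // => l _; rewrite basE neq !mul0r.
Qed.

Lemma trilinear_bas23 (t : gT -> gT -> gT -> K) (a : fvect K gT) j k :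
  trilinear t a (bas K j) (bas K k) = \sum_i a i * t i j k.
Proof.
rewrite /trilinear; apply: eq_bigr => i _.
rewrite (sum_only (i := j)) => [|j' /negbTE neq].
  rewrite (sum_only (i := k)) => [|k' /negbTE neq].
    by rewrite !basE !eqxx !mulr1.
  by rewrite [bas K k _]basE neq mulr0 mul0r.
by rewrite big1 // => k' _; rewrite [bas K j _]basE neq mulr0 !mul0r.
Qed.

Lemma trilinear_bas (t : gT -> gT -> gT -> K) i j k :
  trilinear t (bas K i) (bas K j) (bas K k) = t i j k.
Proof.
rewrite trilinear_bas23 -(sum_delta i (fun i => t i j k)).
by apply: eq_bigr => i' _; rewrite basE.
Qed.

(** * Injectivity and surjectivity in coordinates *)

Section Bijective.
Hypothesis psi_bij : bijective psi.

Lemma dcoord_free :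
  free_on predT (fun gx (hz : gT * gT) => X gx.1 gx.2 hz.1 hz.2).
Proof.
move=> c c0 gx _.
have : psi [ffun gx => c gx] = psi 0.
  apply/ffunP => hz; rewrite linear0 [RHS]ffunE -[RHS](c0 hz) linear_coord.
  by apply: eq_bigr => -[g x] _; rewrite ffunE; case: hz.
by move/(bij_inj psi_bij)/ffunP/(_ gx); rewrite !ffunE.
Qed.

Lemma dcoord_surj h z : exists g x, X g x h z != 0.
Proof.
have [psi' _ psi'K] := psi_bij.
have [|] := boolP [exists gx : gT * gT, X gx.1 gx.2 h z != 0].
  by case/existsP => -[g x]; exists g, x.
move/existsPn => X0; have := psi'K (bas K (h, z)).
move/ffunP/(_ (h, z)); rewrite basE eqxx dcoordE big1 => [/eqP|g _].
  by rewrite eq_sym oner_eq0.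
rewrite big1 // => x _; have := X0 (g, x); rewrite negbK => /eqP->.
by rewrite mulr0.
Qed.

End Bijective.

Section Subgroups.
Variables A B : {group gT}.
Hypothesis pAB : assoc_subgroups (comp_p psi) A B.

Let incl_sgval (y : fvect K [subg B]) b : incl y (sgval b) = y b.
Proof.
rewrite sum_ffunE (sum_only (i := b)) => [|c neq].
  by rewrite scale_basE eqxx mulr1.
by rewrite scale_basE (inj_eq val_inj) eq_sym (negbTE neq) mulr0.
Qed.

Let incl_out (y : fvect K [subg B]) z : z \notin B -> incl y z = 0.
Proof.
move=> nBz; rewrite sum_ffunE big1 // => b _; rewrite scale_basE.
case: eqP => [E|]; last by rewrite mulr0.
by rewrite E subgP in nBz.
Qed.

Lemma comp_p_outA g z : g \notin A -> X g 1%g 1%g z = 0.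
Proof.
move=> nAg; have [_ _ [f _ pE]] := pAB.
have -> : X g 1%g 1%g z = comp_p psi (bas K g) z.
  rewrite comp_pE -(sum_delta g (fun g => X g 1%g 1%g z)).
  by apply: eq_bigr => g' _; rewrite basE.
rewrite pE (_ : restr A (bas K g) = 0) ?linear0.
  by rewrite sum_ffunE big1 // => b _; rewrite scale_basE ffunE mul0r.
apply/ffunP => a; rewrite !ffunE; case: eqP => // E.
by rewrite -E subgP in nAg.
Qed.

Lemma comp_p_outB g z : z \notin B -> X g 1%g 1%g z = 0.
Proof.
move=> nBz; have [_ _ [f _ pE]] := pAB.
have -> : X g 1%g 1%g z = comp_p psi (bas K g) z.
  rewrite comp_pE -(sum_delta g (fun g => X g 1%g 1%g z)).
  by apply: eq_bigr => g' _; rewrite basE.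
by rewrite pE incl_out.
Qed.

Lemma comp_p_free : free_on A (fun g z => X g 1%g 1%g z).
Proof.
move=> c c0 a Aa; have [_ _ [f [_ f_bij] pE]] := pAB.
have : f (restr A [ffun g => c g]) = f 0.
  rewrite linear0; apply/ffunP => b; rewrite -incl_sgval -pE comp_pE ffunE.
  by rewrite -[RHS](c0 (sgval b)); apply: eq_bigr => g _; rewrite ffunE.
move/(bij_inj f_bij)/ffunP/(_ (subg A a)).
by rewrite !ffunE subgK.
Qed.

Lemma comp_p_surj b : b \in B ->
  exists c : gT -> K, forall z, \sum_g c g * X g 1%g 1%g z = (z == b)%:R.
Proof.
move=> Bb; have [_ _ [f [_ [f' _ f'K]] pE]] := pAB.
pose y := f' (bas K (subg B b)).
(* Outside [A], [subg A] returns the default element 1; [restr] discards these values. *)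
exists (fun g => y (subg A g)) => z.
transitivity (comp_p psi [ffun g => y (subg A g)] z).
  by rewrite comp_pE; apply: eq_bigr => g _; rewrite ffunE.
rewrite pE (_ : restr A _ = y) => [|].
  rewrite f'K; have [Bz|nBz] := boolP (z \in B).
    rewrite -{1}(@subgK _ B z Bz) incl_sgval basE.
    by rewrite (inj_in_eq (can_in_inj (@subgK _ B))).
  rewrite incl_out //; by case: eqP => // E; rewrite E Bb in nBz.
by apply/ffunP => a; rewrite !ffunE sgvalK.
Qed.

End Subgroups.

Lemma rigidE : rigid psi
  <-> double_morphism (fun _ _ _ => 1) (fun _ _ _ => 1) (dcoord psi).
Proof.
split=> [[/bialg_morphismE //] | XH].
by apply: bialg_morphism_antipode; apply/bialg_morphismE.
Qed.

Theorem rigid_iff (omega eta : gT -> gT -> gT -> K) (A B : {group gT}) :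
  let p := comp_p psi in
  let u' := dual_map (comp_u psi) in
  let v := comp_v psi in
  let e := @bas K gT in
  cocycle3 omega -> cocycle3 eta ->
  quasi_bialg_isomorphism (tdouble omega) (tdouble eta) psi ->
  assoc_subgroups p A B ->
  let inB := fun y : fvect K gT => exists2 b, b \in B & y = e b in
  let inImv := fun y : fvect K gT => exists g, y = v (e g) in
  rigid psi <->
  [/\ cocycle3_quo A omega,
      forall g x y : gT,
        trilinear (gamma omega) (e g) (u' (e x)) (u' (e y)) =
        trilinear (gamma eta) (v (e g)) (e x) (e y),
      forall g h x : gT,
        trilinear (theta omega) (u' (e x)) (e g) (e h) =
        trilinear (theta eta) (e x) (v (e g)) (v (e h)),
      forall (x : gT) (y z : fvect K gT),
        [\/ inB y /\ inImv z, inImv y /\ inB z | inB y /\ inB z] ->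
        trilinear (theta eta) (e x) y z = 1
    & forall (b x y : gT), b \in B ->
        trilinear (gamma eta) (e b) (e x) (e y) = 1].
Proof.
move=> p u' v e cw ce [[psiH psiA] psi_bij] pAB inB inImv.
have /bialg_morphismE XH : bialg_morphism (tdouble_bialg omega)
  (tdouble_bialg eta) psi by [].
have Xassoc h z h' z' h'' z'' : \sum_a \sum_b \sum_c (omega a b c)^-1
      * (X a 1%g h z * X b 1%g h' z' * X c 1%g h'' z'')
    = (z == 1%g)%:R * (z' == 1%g)%:R * (z'' == 1%g)%:R * (eta h h' h'')^-1.
  by rewrite -tens_map_coassoc psiA coassocE.
have Xfree := dcoord_free psi_bij; have Xsurj := dcoord_surj psi_bij.
have [abA abB _] := pAB.
have p_outA := comp_p_outA pAB; have p_outB := comp_p_outB pAB.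
have p_free := comp_p_free pAB; have p_surj := comp_p_surj pAB.
have cA := A_central cw ce XH Xfree abA p_outA p_free.
have wA := omega_translate cw ce XH Xassoc Xfree abA p_outA p_free.
have [v0 Qv] := v_exists cw ce XH Xassoc Xfree abA p_outA p_free.
have QE := QE cw ce XH Xassoc Xfree abA p_outA p_free Qv.
have vM := vM cw ce XH Xassoc Xfree abA p_outA p_free Qv.
have cB b g := @B_central _ _ _ _ _ _ _ cw ce XH Xfree Xsurj abA abB p_outA
  p_outB p_free p_surj v0 Qv b g.
have Pf := P_factor cw ce XH.
have X1 : forall h z, \sum_g X g 1%g h z = (z == 1%g)%:R by case: XH.
have eigen b : b \in B -> exists f f' b', [/\ homogeneous X f b,
    homogeneous X f' b' & forall g, f g * f' g = 1].
  move=> Bb; have [c cb] := p_surj b Bb; have [c' cb'] := p_surj _ (groupVr Bb).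
  (* The characters of [A] attached to b and b^-1, extended by the same representatives, stay
     inverse to each other on all of G. *)
  pose shift c g : K := c (g * (repr (A :* g))^-1)%g.
  exists (shift c), (shift c'), b^-1%g; split=> [||g].
  - apply: (eigen_homogeneous p_outA Pf cb); apply: eigenfunction_extend.
    exact: (chi_mul cw ce XH p_free cb).
  - apply: (eigen_homogeneous p_outA Pf cb'); apply: eigenfunction_extend.
    exact: (chi_mul cw ce XH p_free cb').
  - apply: (chi_inv cw ce XH p_free cb cb').
    by rewrite -mem_rcoset rcoset_repr rcoset_refl.
(* Links the linear component [v] of the statement with the group map [v0] of the coordinate
   lemmas. *)
have veE g : v (e g) = e (v0 g).
  by apply/ffunP => z; rewrite comp_vE Qv basE.
have gammaE g x y : trilinear (gamma omega) (e g) (u' (e x)) (u' (e y))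
    = \sum_a \sum_b um X a x * um X b y * gamma omega g a b.
  rewrite trilinear_bas1; apply: eq_bigr => a _; apply: eq_bigr => b _.
  by rewrite !dual_comp_uE.
have thetaE g h x : trilinear (theta omega) (u' (e x)) (e g) (e h)
    = uf X (fun k => theta omega k g h) x.
  rewrite trilinear_bas23; apply: eq_bigr => k _.
  by rewrite dual_comp_uE mulrC.
have toP := rigid_phase_conditions cA cB p_outA Pf X1 QE vM cw ce XH wA eigen.
have ofP := phase_conditions_rigid cA cB p_outA p_outB Pf X1 QE vM cw ce XH wA.
apply: (iff_trans rigidE); split.
  move=> /toP[c2 c3 c4v c4b c5]; split.
  - exact: translation_invariant_quo cA cw wA.
  - by move=> g x y; rewrite gammaE c2 veE trilinear_bas.
  - by move=> g h x; rewrite thetaE c3 !veE trilinear_bas.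
  - move=> x y z [[[b Bb ->] [g ->]]|[[g ->] [b Bb ->]]|[[b Bb ->] [b' Bb' ->]]].
    + by rewrite veE trilinear_bas (c4v _ _ _ Bb).1.
    + by rewrite veE trilinear_bas (c4v _ _ _ Bb).2.
    + by rewrite trilinear_bas c4b.
  - by move=> b x y Bb; rewrite trilinear_bas c5.
move=> [_ c2 c3 c4 c5]; apply: ofP; split.
- by move=> g x y; rewrite -gammaE c2 veE trilinear_bas.
- by move=> g h x; rewrite -thetaE c3 !veE trilinear_bas.
- move=> x b g Bb; rewrite -!(trilinear_bas (theta eta)) -!/(e _) -veE.
  have eB : inB (e b) by exists b.
  have ev : inImv (v (e g)) by exists g.
  by split; apply: c4; [apply: Or31 | apply: Or32].
- move=> x b b' Bb Bb'; rewrite -(trilinear_bas (theta eta)).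
  by apply: c4; apply: Or33; split; [exists b | exists b'].
- by move=> b x y Bb; rewrite -(trilinear_bas (gamma eta)) c5.
Qed.

End Components.

Theorem theorem12p3 (R : realType) (gT : finGroupType)
    (omega eta : gT -> gT -> gT -> R[i])
    (psi : {linear fvect R[i] (gT * gT)%type -> fvect R[i] (gT * gT)%type})
    (A B : {group gT}) :
  let p := comp_p psi in
  let u' := dual_map (comp_u psi) in
  let v := comp_v psi in
  let e := @bas R[i] gT in
  cocycle3 omega -> cocycle3 eta ->
  quasi_bialg_isomorphism (tdouble omega) (tdouble eta) psi ->
  assoc_subgroups p A B ->
  let inB := fun y => exists2 b, b \in B & y = e b in
  let inImv := fun y => exists g, y = v (e g) in
  rigid psi <->
  [/\ cocycle3_quo A omega,
      forall g x y : gT,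
        trilinear (gamma omega) (e g) (u' (e x)) (u' (e y)) =
        trilinear (gamma eta) (v (e g)) (e x) (e y),
      forall g h x : gT,
        trilinear (theta omega) (u' (e x)) (e g) (e h) =
        trilinear (theta eta) (e x) (v (e g)) (v (e h)),
      forall (x : gT) (y z : fvect R[i] gT),
        [\/ inB y /\ inImv z, inImv y /\ inB z | inB y /\ inB z] ->
        trilinear (theta eta) (e x) y z = 1
    & forall (b x y : gT), b \in B ->
        trilinear (gamma eta) (e b) (e x) (e y) = 1].
Proof. exact: rigid_iff. Qed.
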